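(* Let $\mathbf{A}\subset\mathbb{R}^n$ be a finite point configuration affinely spanning $\mathbb{R}^n$ and let $\Sigma(h)$ be a regular triangulation of $\mathbf{A}$ (with $h$ generic). The MST-fan $\mathcal{K}(h)$ is a pure fan in $\mathbb{R}^{\mathbf{A}}$ with full support $\bigcup_{c\in\mathcal{K}(h)}c=\operatorname{sc}(h)$. Two height functions $f,g\in\operatorname{sc}(h)$ are in the same cone of $\mathcal{K}(h)$ if and only if there is an ordered spanning tree $T_<$ of $\Gamma(h)$ with $T_{\min}(f)=_\lozenge T_<=_\lozenge T_{\min}(g)$. In particular, the maximal cones of $\mathcal{K}(h)$ are in bijection with the realizable ordered spanning trees of $\Gamma(h)$.
   Context: For $g\in\mathbb{R}^{\mathbf{A}}$, $\Sigma(g)$ is the regular subdivision of $\mathbf{A}$ whose maximal cells are the projections of the upper facets of $\operatorname{conv}\{(v,g(v))\colon v\in\mathbf{A}\}$, and $\Gamma(g)$ is its dual graph (nodes: maximal cells; edges: pairs of maximal cells sharing a facet). The secondary cone $\operatorname{sc}(h)$ is the closure of $\{g\colon\Sigma(g)=\Sigma(h)\}$, a full-dimensional polyhedral cone; for $g$ in its interior $\Gamma(g)=\Gamma(h)$. A height function is generic if it avoids a fixed finite union of proper linear subspaces of $\mathbb{R}^{\mathbf{A}}$. For an edge $r$ of $\Gamma(h)$ consisting of adjacent simplices $\operatorname{conv}(v_1,\ldots,v_{n+1})$ and $\operatorname{conv}(v_2,\ldots,v_{n+2})$, the tropical edge length is $L_g(r):=|\det M_g(r)|$, where $M_g(r)$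 is the $(n+2)\times(n+2)$ matrix with rows $(1,v_{i,1},\ldots,v_{i,n},g(v_i))$. The greedy (Kruskal) algorithm on an edge-weighted graph processes edges by non-decreasing weight, ties broken arbitrarily, inserting an edge iff it closes no cycle. An ordered spanning tree $T_<$ is a spanning tree of $\Gamma(h)$ with an enumeration of its edges; $T_{\min}(g)=_\lozenge T_<$ means the greedy algorithm on $\Gamma(g)$ weighted by $L_g$ can output $T_<$ (these edges inserted in this order). $T_<$ is realizable if $T_{\min}(g)=_\lozenge T_<$ for some $g\in\operatorname{sc}(h)$. The MST-cone $\mathcal{K}(T_<)$ of a realizable $T_<$ is the set of generic $g\in\operatorname{sc}(h)$ with $T_{\min}(g)=_\lozenge T_<$, regarded as a closed cone (taking closure). The MST-fan $\mathcal{K}(h)$ is the collection of all MST-cones $\mathcal{K}(T_<)$, $T_<$ ranging over realizable ordered spanning trees of $\Gamma(h)$ (together with their faces).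
   Formalization: The bijection is proved up to ties (trees output by one generic g share a cone) and literally when edge lengths at h are distinct, as identical lengths make it false; realizable means by a generic g; greedy runs on Γ(h) also for g on the boundary of sc(h). *)

(* Defs.v *)
From HB Require Import structures.
From mathcomp Require Import all_boot all_order all_algebra.
From mathcomp Require Import boolp classical_sets functions cardinality reals.
From mathcomp Require Import topology normedtype.

Set Implicit Arguments.
Unset Strict Implicit.
Unset Printing Implicit Defensive.

Import Order.TTheory GRing.Theory Num.Theory.
Import numFieldNormedType.Exports.

Local Open Scope ring_scope.

(* Graphs on a finite type of nodes; an edge is a two-element set of nodes,
   and a list of edges records the order of insertion. *)
Section Graph.
Variable V : finType.
Implicit Types (N : {set V}) (E : {set {set V}}) (T es : seq {set V}).

Definition edge_rel T : rel V := fun x y => ([set x; y]%SET \in T).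

Definition has_cycle T : Prop :=
  exists c : seq V, (2 < size c)%N /\ ucycle (edge_rel T) c.

Definition ordered_spanning_tree_of N E T : Prop :=
  [/\ uniq T, {subset T <= E}, ~ has_cycle T
    & {in N &, forall x y, connect (edge_rel T) x y}].

Definition kruskal es : seq {set V} :=
  foldl (fun T e => if `[< has_cycle (rcons T e) >] then T else rcons T e)
        [::] es.

(* The list es is a processing order; quantifying over all sorted
   enumerations of E accounts for the arbitrary breaking of ties. *)
Definition greedy_output (R : realType) E (w : {set V} -> R) T : Prop :=
  exists es, [/\ perm_eq es (enum E),
                 sorted (fun r s => w r <= w s) es & kruskal es = T].

End Graph.

Section PointConfiguration.
Variables (R : realType) (m : nat).

(* A finite family of points is a function p on 'I_m, and a subset S of 'I_m
   stands for the polytope conv (p @ S) together with its marked points. *)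

Definition hom (k : nat) (x : 'rV[R]_k) : 'rV[R]_(1 + k) :=
  row_mx (const_mx 1) x.

(* One more than the dimension of the affine hull of the points p i, i in S. *)
Definition affrank (k : nat) (p : 'I_m -> 'rV[R]_k) (S : {set 'I_m}) : nat :=
  \rank (\matrix_(i < m) (if i \in S then hom (p i) else 0)).

(* The face of conv (p @ S) on which the linear functional c is maximal. *)
Definition exposed_face (k : nat) (p : 'I_m -> 'rV[R]_k) (S : {set 'I_m})
    (c : 'rV[R]_k) : {set 'I_m} :=
  [set i in S | [forall (j | j \in S),
     (c *m (p j)^T) 0 0 <= (c *m (p i)^T) 0 0]]%SET.

Variables (n : nat) (a : 'I_m -> 'rV[R]_n).
(* A height function g : A -> R is the row vector of its values g (a i). *)
Implicit Types (f g h : 'rV[R]_m).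

Definition affinely_spanning : Prop := affrank a [set: 'I_m]%SET = n.+1.

Definition lift_pt g (i : 'I_m) : 'rV[R]_(n + 1) :=
  row_mx (a i) (g 0 i)%:M.

Definition upper_facet g (S : {set 'I_m}) : Prop :=
  exists (b : 'rV[R]_n) (t : R),
    [/\ 0 < t,
        S = exposed_face (lift_pt g) [set: 'I_m]%SET (row_mx b t%:M)
      & affrank (lift_pt g) S = n.+1].

(* The maximal cells of the regular subdivision induced by g, each given by
   the set of all points of the configuration lifted onto the upper facet. *)
Definition Sigma g : {set {set 'I_m}} := [set S | `[< upper_facet g S >]]%SET.

Definition triangulation g : Prop :=
  {in Sigma g, forall S : {set 'I_m}, #|S| = n.+1}.

Definition facet_of (S F : {set 'I_m}) : Prop :=
  (exists c : 'rV[R]_n, F = exposed_face a S c) /\ affrank a F = n.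

Definition Gamma g : {set {set {set 'I_m}}} :=
  [set r | `[< exists S S' : {set 'I_m},
     [/\ S \in Sigma g, S' \in Sigma g, S != S', r = [set S; S']%SET
       & exists F, facet_of S F /\ facet_of S' F] >]]%SET.

Definition height_mx g (s : seq 'I_m) : 'M[R]_(1 + (n + 1)) :=
  \matrix_(i < 1 + (n + 1)) nth 0 [seq hom (lift_pt g j) | j <- s] i.

(* For r = {S, S'} the set cover r is the union of S and S', of cardinal n + 2
   in a triangulation; the order of the rows does not affect the length. *)
Definition edge_length g (r : {set {set 'I_m}}) : R :=
  `|\det (height_mx g (enum (finset.cover r)))|.

Local Open Scope classical_set_scope.

(* As s and t range over all (n + 2)-tuples of points, these subspaces include
   the ones where a determinant vanishes (take t constant) and the ones where
   two determinants are opposite (exchange two entries of t). *)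
Definition tie_space (s t : (1 + (n + 1)).-tuple 'I_m) : set 'rV[R]_m :=
  [set g | \det (height_mx g s) = \det (height_mx g t)].

Definition generic g : Prop :=
  forall s t, tie_space s t <> setT -> ~ tie_space s t g.

Definition secondary_cone h : set 'rV[R]_m :=
  closure [set g | Sigma g = Sigma h].

Definition ordered_spanning_tree h (T : seq {set {set 'I_m}}) : Prop :=
  ordered_spanning_tree_of (Sigma h) (Gamma h) T.

(* The graph is Gamma h, which equals Gamma g whenever Sigma g = Sigma h; on
   the boundary of the secondary cone some edges may get length 0. *)
Definition Tmin h g (T : seq {set {set 'I_m}}) : Prop :=
  greedy_output (Gamma h) (edge_length g) T.

Definition mst_generic_cone h (T : seq {set {set 'I_m}}) : set 'rV[R]_m :=
  [set g | [/\ generic g, secondary_cone h g & Tmin h g T]].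

Definition realizable h (T : seq {set {set 'I_m}}) : Prop :=
  ordered_spanning_tree h T /\ exists g, mst_generic_cone h T g.

Definition mst_cone h (T : seq {set {set 'I_m}}) : set 'rV[R]_m :=
  closure (mst_generic_cone h T).

End PointConfiguration.

Local Open Scope classical_set_scope.

Section Fan.
Variables (R : realType) (m : nat).
Implicit Types (C D : set 'rV[R]_m) (K : set (set 'rV[R]_m)).

Definition polyhedral_cone C : Prop :=
  exists (k : nat) (B : 'M[R]_(m, k)),
    C = [set x | forall j, 0 <= (x *m B) 0 j].

(* The zero functional gives C as a face of itself. *)
Definition cone_face C D : Prop :=
  exists c : 'cV[R]_m, (forall x, C x -> 0 <= (x *m c) 0 0) /\
    D = [set x | C x /\ (x *m c) 0 0 = 0].

(* Cones are not required to be pointed. *)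
Definition is_fan K : Prop :=
  [/\ finite_set K,
      forall C, K C -> polyhedral_cone C,
      forall C D, K C -> cone_face C D -> K D
    & forall C D, K C -> K D ->
        cone_face C (C `&` D) /\ cone_face D (C `&` D)].

Definition maximal_cones K : set (set 'rV[R]_m) :=
  [set C | K C /\ forall D, K D -> C `<=` D -> D = C].

(* The rows of B form a basis, contained in C, of the linear span of C. *)
Definition cone_dim C (d : nat) : Prop :=
  exists B : 'M[R]_(d, m),
    [/\ row_free B, forall i, C (row i B) & forall x, C x -> (x <= B)%MS].

Definition pure K : Prop :=
  exists d, forall C, maximal_cones K C -> cone_dim C d.

End Fan.

Definition mst_fan (R : realType) (m n : nat) (a : 'I_m -> 'rV[R]_n)
    (h : 'rV[R]_m) : set (set 'rV[R]_m) :=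
  [set C | exists T, realizable a h T /\ cone_face (mst_cone a h T) C].

(* Main.v *)
Require Import Defs.
From mathcomp Require Import all_boot all_order all_algebra perm.
From mathcomp Require Import boolp classical_sets functions cardinality reals.
From mathcomp Require Import topology normedtype.
From mathcomp Require Import zify ring lra.

Set Implicit Arguments.
Unset Strict Implicit.
Unset Printing Implicit Defensive.

Import Order.TTheory GRing.Theory Num.Theory.
Import numFieldNormedType.Exports.

Local Open Scope ring_scope.

(** Order the edges of a spanning tree T as e_1, ..., e_N and let W_T(w) be the
    sum over k of w(e_1) + ... + w(e_k).  Acyclic edge sets form a matroid, so
    the greedy algorithm minimizes every one of these partial sums at once, and
    T is a greedy output for the weights w iff W_T(w) is minimal among all
    ordered spanning trees.  On sc(h) every edge length is a linear function of
    the height g (its determinant cannot change sign there), hence the cones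
    {g in sc(h) | T is a greedy output at g} are cut out of sc(h) by the domains
    of linearity of the minimum of finitely many linear functions W_T(g); this
    makes them a fan.  A generic g determines which edge lengths agree
    identically, so it is an interior point of each cone containing it, and
    generic points are dense because x + t g is generic for small t > 0.

    The description of sc(h) by linear inequalities and the connectedness of the
    dual graph both come from the simplex method: maximal cells are the vertices
    of the polyhedron of affine functions lying above h, and a pivot moves to an
    adjacent cell while lowering the value at a prescribed cell. *)

Local Notation dotp x c := ((x *m c) 0 0).
Local Notation hom := Defs.hom.

(** * Forests and the greedy algorithm *)

Section Forests.
Variable V : finType.
Implicit Types (N : {set V}) (E : {set {set V}}) (T es : seq {set V}).

Lemma edge_rel_sym T : symmetric (edge_rel T).
Proof. by move=> x y; rewrite /edge_rel finset.setUC. Qed.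

Lemma edge_rel_sub T T' : {subset T <= T'} -> subrel (edge_rel T) (edge_rel T').
Proof. by move=> sTT' x y; apply: sTT'. Qed.

Lemma connect_edge_rel_sym T : connect_sym (edge_rel T).
Proof. exact/sym_connect_sym/edge_rel_sym. Qed.

Lemma has_cycle_sub T T' : {subset T <= T'} -> has_cycle T -> has_cycle T'.
Proof.
move=> sTT' [c [c_gt2 /andP[cT Uc]]]; exists c; split=> //.
by apply/andP; split=> //; apply: sub_cycle cT; apply: edge_rel_sub.
Qed.

Lemma acyclic_take k T : ~ has_cycle T -> ~ has_cycle (take k T).
Proof. by move=> nT cT; apply/nT/(has_cycle_sub _ cT) => e /mem_take. Qed.

Lemma has_cycle_nil : ~ @has_cycle V [::].
Proof. by move=> [[|x [|y c]] [// _ /andP[/= /andP[]]]]. Qed.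

Lemma connect_has_cycle T x y : x != y -> [set x; y]%SET \notin T ->
  connect (edge_rel T) x y -> has_cycle (rcons T [set x; y]%SET).
Proof.
move=> xy xyT /connectP[p pT]; case/shortenP: pT => q qT Uq _ yE.
exists (x :: q); split.
  case: q qT {Uq} yE => [_ /= yx|z [|//] /= /andP[xz _] yz].
    by rewrite yx eqxx in xy.
  by move: xz xyT; rewrite /edge_rel yz => ->.
apply/andP; split=> //; rewrite /cycle rcons_path -yE.
apply/andP; split; last by rewrite /edge_rel finset.setUC mem_rcons mem_head.
by apply: sub_path qT; apply: edge_rel_sub => e eT; rewrite mem_rcons inE eT orbT.
Qed.

Lemma has_cycle_connect T x y : ~ has_cycle T ->
  has_cycle (rcons T [set x; y]%SET) -> connect (edge_rel T) x y.
Proof.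
move=> nT [c [c_gt2 /andP[cT' Uc]]].
have [z zc zT] : exists2 z, z \in c & ~~ edge_rel T z (next c z).
  apply: contrapT => nz; apply: nT; exists c; split=> //; apply/andP; split=> //.
  apply: cycle_from_next => // z zc; apply: contrapT => /negP zT.
  by apply: nz; exists z.
have eE : [set z; next c z]%SET = [set x; y]%SET.
  have := next_cycle cT' zc; rewrite /edge_rel mem_rcons inE => /orP[/eqP//|].
  by move: zT; rewrite /edge_rel => /negbTE->.
have [i p rE] := rot_to zc.
have Ur : uniq (z :: p) by rewrite -rE rot_uniq.
have cr : cycle (edge_rel (rcons T [set x; y]%SET)) (z :: p).
  by rewrite -rE rot_cycle.
have pgt1 : (1 < size p)%N by rewrite -ltnS -/(size (z :: p)) -rE size_rot.
have nE : next c z = head z p.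
  by rewrite -(next_rot i Uc) rE /=; case: (p) => [|? ?] /=; rewrite eqxx.
case: p => // z' q in rE Ur cr pgt1 nE.
rewrite /= in nE; move: eE; rewrite nE => eE.
have czz' : connect (edge_rel T) z' z.
  move: cr; rewrite /= rcons_path => /and3P[_ pq lq].
  move: Ur; rewrite /= inE negb_or => /and3P[/andP[zz' zq] z'q _].
  have lz'q : last z' q \in q by case: (q) pgt1 => //= u q' _; rewrite mem_last.
  apply: (connect_trans (y := last z' q)).
    apply/connectP; exists q => //.
    apply: (sub_in_path (P := predC1 z)) pq => [u v uz vz|]; last first.
      apply/allP => u; rewrite inE => /orP[/eqP->|uq]; first by rewrite inE eq_sym.
      by rewrite inE; apply: contraNneq zq => <-.
    rewrite /edge_rel mem_rcons inE => /orP[/eqP uvE|//].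
    have : z \in [set u; v]%SET by rewrite uvE -eE !inE eqxx.
    by rewrite !inE ![z == _]eq_sym; move: uz vz; rewrite !inE => /negbTE-> /negbTE->.
  apply: connect1; move: lq; rewrite /edge_rel mem_rcons inE => /orP[/eqP uvE|//].
  have : z' \in [set last z' q; z]%SET by rewrite uvE -eE !inE eqxx orbT.
  rewrite !inE [z' == z]eq_sym (negbTE zz') orbF => /eqP z'E.
  by rewrite z'E lz'q in z'q.
have : x \in [set z; z']%SET by rewrite eE !inE eqxx.
have : y \in [set z; z']%SET by rewrite eE !inE eqxx orbT.
have : z \in [set x; y]%SET by rewrite -eE !inE eqxx.
have : z' \in [set x; y]%SET by rewrite -eE !inE eqxx orbT.
rewrite !inE; have czz := czz'; rewrite connect_edge_rel_sym in czz.
move=> h1 h2 /orP[]/eqP yE /orP[]/eqP xE //.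
- by rewrite xE yE connect0.
- by rewrite xE yE.
- by rewrite xE yE.
by rewrite xE yE connect0.
Qed.

(* Edges become incidence vectors modulo 2: acyclicity is linear independence
   and lying in the span is being connected, so that augmentation is the
   Steinitz exchange lemma. *)
Definition incidence (e : {set V}) : {ffun V -> ('F_2)^o} :=
  [ffun x => (x \in e)%:R].

Lemma addff2 (x : ('F_2)^o) : x + x = 0.
Proof. by apply/eqP; case: x => [[|[|?]] ?]. Qed.

Lemma incidence2 x y : x != y ->
  incidence [set x; y]%SET = incidence [set x]%SET + incidence [set y]%SET.
Proof.
move=> xy; apply/ffunP => z; rewrite !ffunE !inE.
case: (eqVneq z x) => [->|_]; last by rewrite add0r.
by rewrite (negbTE xy) addr0.
Qed.

Lemma span_component_sum T x (u : {ffun V -> ('F_2)^o}) :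
  {in T, forall e : {set V}, #|e| = 2} ->
  u \in <<[seq incidence e | e <- T]>>%VS ->
  \sum_(z | connect (edge_rel T) x z) u z = 0.
Proof.
move=> T2 uT; rewrite (coord_span (X := in_tuple _) uT).
under eq_bigr do rewrite sum_ffunE.
rewrite exchange_big big1 //= => i _.
under eq_bigr do rewrite ffunE.
rewrite -scaler_sumr (nth_map finset.set0); last by rewrite -(size_map incidence).
set e := nth _ _ _.
have eT : e \in T by apply: mem_nth; rewrite -(size_map incidence).
have /eqP/cards2P[v1 [v2 [v12 eE]]] := T2 _ eT.
under eq_bigr do rewrite eE incidence2 // !ffunE !inE.
rewrite big_split /=.
have sum1 v : \sum_(z | connect (edge_rel T) x z) ((z == v)%:R : ('F_2)^o)
   = (connect (edge_rel T) x v)%:R.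
  rewrite big_mkcond (bigD1 v) //= eqxx big1 ?addr0; first by case: connect.
  by move=> z /negbTE->; case: connect.
rewrite !sum1.
have -> : connect (edge_rel T) x v2 = connect (edge_rel T) x v1.
  have c12 : connect (edge_rel T) v1 v2 by apply: connect1; rewrite /edge_rel -eE.
  rewrite connect_edge_rel_sym [RHS]connect_edge_rel_sym.
  by rewrite (same_connect (connect_edge_rel_sym T) c12).
by rewrite addff2 scaler0.
Qed.

Lemma acyclic_free T : {in T, forall e : {set V}, #|e| = 2} -> uniq T ->
  ~ has_cycle T -> free [seq incidence e | e <- T].
Proof.
elim/last_ind: T => [|T e IH] T2; first by rewrite nil_free.
rewrite rcons_uniq => /andP[eT UT] nc.
have sT : {subset T <= rcons T e} by move=> r rT; rewrite mem_rcons inE rT orbT.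
have T2' : {in T, forall e : {set V}, #|e| = 2} by move=> r /sT /T2.
rewrite map_rcons (perm_free (permEl (perm_rcons _ _))) free_cons IH //; last first.
  by move=> /(has_cycle_sub sT).
rewrite andbT; apply/negP.
have /eqP/cards2P[x [y [xy eE]]] := T2 e ltac:(by rewrite mem_rcons mem_head).
move=> /(span_component_sum x T2').
rewrite (eq_bigr (fun z => ((z == x) || (z == y))%:R)); last first.
  by move=> z _; rewrite ffunE eE !inE.
have nxy : ~~ connect (edge_rel T) x y.
  by apply/negP => cxy; apply: nc; rewrite eE; apply: connect_has_cycle; rewrite -?eE.
rewrite (bigD1 x) ?connect0 //= eqxx big1 ?addr0; first by move/eqP; rewrite oner_eq0.
move=> z /andP[xz zx]; rewrite (negbTE zx) /=.
by case: eqP => // zy; rewrite -zy xz in nxy.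
Qed.

Lemma connect_incidence T x y : {in T, forall e : {set V}, #|e| = 2} ->
  connect (edge_rel T) x y ->
  incidence [set x]%SET + incidence [set y]%SET
    \in <<[seq incidence e | e <- T]>>%VS.
Proof.
move=> T2 /connectP[p]; elim: p x => [|z p IH] x /=.
  move=> _ ->; set u := incidence _.
  suff -> : u + u = 0 by rewrite mem0v.
  by apply/ffunP => z; rewrite !ffunE addff2.
case/andP=> xz pT yE; have IHz := IH z pT yE.
have xz' : x != z.
  by apply/eqP => xzE; have := T2 _ xz; rewrite xzE finset.setUid cards1.
have -> : incidence [set x]%SET + incidence [set y]%SET =
    incidence [set x; z]%SET + (incidence [set z]%SET + incidence [set y]%SET).
  rewrite incidence2 // addrA -[_ + _ + incidence [set z]%SET]addrA.
  set u := incidence [set z]%SET; suff -> : u + u = 0 by rewrite addr0.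
  by apply/ffunP => v; rewrite !ffunE addff2.
by apply: memvD => //; apply: memv_span; apply: map_f.
Qed.

Lemma acyclic_augment T T' :
  {in T, forall e : {set V}, #|e| = 2} -> {in T', forall e : {set V}, #|e| = 2} ->
  ~ has_cycle T -> uniq T' -> ~ has_cycle T' -> (size T < size T')%N ->
  exists e, [/\ e \in T', e \notin T & ~ has_cycle (rcons T e)].
Proof.
move=> T2 T'2 ncT UT' ncT' ltTT'; apply: contrapT => nex.
have sub : (<<[seq incidence e | e <- T']>> <= <<[seq incidence e | e <- T]>>)%VS.
  apply/span_subvP => _ /mapP[e eT' ->].
  have [eT|eT] := boolP (e \in T); first by apply: memv_span; apply: map_f.
  have /eqP/cards2P[x [y [xy eE]]] := T'2 _ eT'.
  rewrite eE incidence2 //; apply: connect_incidence => //.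
  apply: has_cycle_connect => //; apply: contrapT => nc.
  by apply: nex; exists e; rewrite eE in eT' eT *.
have := dimvS sub; have /eqP -> := acyclic_free T'2 UT' ncT'.
move=> /leq_trans /(_ (dim_span _)); rewrite !size_map => /(leq_trans ltTT').
by rewrite ltnn.
Qed.

Definition greedy_for E (le : rel {set V}) T : Prop :=
  forall (i : nat) r, (i < size T)%N -> r \in E -> r \notin take i T ->
    ~ has_cycle (rcons (take i T) r) -> le (nth finset.set0 T i) r.

Lemma kruskal_rcons es e : kruskal (rcons es e) =
  if `[< has_cycle (rcons (kruskal es) e) >] then kruskal es
  else rcons (kruskal es) e.
Proof. by rewrite /kruskal foldl_rcons. Qed.

Lemma kruskal_uniq_sub es : uniq es ->
  [/\ uniq (kruskal es), {subset kruskal es <= es} & ~ has_cycle (kruskal es)].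
Proof.
elim/last_ind: es => [|es e IH]; first by split=> //; apply: has_cycle_nil.
rewrite rcons_uniq => /andP[ees /IH[UK sK nK]]; rewrite kruskal_rcons.
case: asboolP => nc; split=> //.
- by move=> r /sK res; rewrite mem_rcons inE res orbT.
- by rewrite rcons_uniq UK andbT; apply: contra ees; apply: sK.
by move=> r; rewrite !mem_rcons !inE => /orP[->//|/sK ->]; rewrite orbT.
Qed.

Lemma kruskal_maximal es r : r \in es -> r \notin kruskal es ->
  has_cycle (rcons (kruskal es) r).
Proof.
elim/last_ind: es => [//|es e IH]; rewrite mem_rcons inE kruskal_rcons.
case: asboolP => nc.
  by move=> /orP[/eqP->//|]; apply: IH.
rewrite mem_rcons inE negb_or => /orP[->//|res] /andP[_ rK].
apply: has_cycle_sub (IH res rK) => s; rewrite !mem_rcons !inE mem_rcons inE.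
by move=> /orP[->|->]; rewrite ?orbT.
Qed.

Lemma kruskal_greedy E (le : rel {set V}) es :
  reflexive le -> transitive le -> sorted le es -> es =i E -> uniq es ->
  greedy_for E le (kruskal es).
Proof.
move=> le_refl le_tr les esE Ues.
suff gen : forall i r, (i < size (kruskal es))%N -> r \in es ->
    r \notin take i (kruskal es) -> ~ has_cycle (rcons (take i (kruskal es)) r) ->
    le (nth finset.set0 (kruskal es) i) r.
  by move=> i r ik; rewrite -esE; apply: gen.
elim/last_ind: es les Ues {esE} => [//|es e IH] les Ues.
have Ues' : uniq es by move: Ues; rewrite rcons_uniq => /andP[].
have les' : sorted le es.
  by move: les; apply: subseq_sorted => //; apply: subseq_rcons.
have /allP lee : all (le^~ e) es.
  by move: les; rewrite sorted_pairwise // pairwise_rcons => /andP[].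
have [_ sK _] := kruskal_uniq_sub Ues'.
move=> i r; rewrite kruskal_rcons; case: asboolP => nc.
  move=> ik; rewrite mem_rcons inE => /orP[/eqP-> _ _|res]; last exact: IH.
  by apply: lee; apply: sK; apply: mem_nth.
rewrite size_rcons ltnS leq_eqVlt => /orP[/eqP->|ik].
  rewrite nth_rcons ltnn eqxx -[rcons (kruskal es) e]cats1 take_size_cat //.
  rewrite mem_rcons inE => /orP[/eqP->//|res] rK nr.
  by case: nr; apply: kruskal_maximal.
rewrite nth_rcons ik -[rcons (kruskal es) e]cats1 takel_cat ?(ltnW ik) //.
rewrite mem_rcons inE => /orP[/eqP-> _ _|res]; last exact: IH.
by apply: lee; apply: sK; apply: mem_nth.
Qed.

Definition graph_on N E : Prop :=
  {in E, forall e : {set V}, e \subset N /\ #|e| = 2}.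

Section SpanningTrees.
Variables (N : {set V}) (E : {set {set V}}).
Hypothesis graphE : graph_on N E.

Local Notation ost := (ordered_spanning_tree_of N E).

Lemma sub_card2 T : {subset T <= E} -> {in T, forall e : {set V}, #|e| = 2}.
Proof. by move=> sT e /sT /graphE[]. Qed.

Lemma spanning_tree_maximal T r : ost T -> r \in E -> r \notin T ->
  has_cycle (rcons T r).
Proof.
move=> [UT sT nT cT] rE rT; have [rN /eqP/cards2P[x [y [xy rxy]]]] := graphE rE.
rewrite rxy in rN rT *; apply: connect_has_cycle => //.
by apply: cT; apply: (fintype.subsetP rN); rewrite !inE eqxx ?orbT.
Qed.

Lemma acyclic_size_le T I : ost T -> uniq I -> {subset I <= E} ->
  ~ has_cycle I -> (size I <= size T)%N.
Proof.
move=> oT UI sI nI; rewrite leqNgt; apply/negP => ltTI; have [_ sT nT _] := oT.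
have [e [eI eT]] := acyclic_augment (sub_card2 sT) (sub_card2 sI) nT UI nI ltTI.
by apply; apply: spanning_tree_maximal => //; apply: sI.
Qed.

Lemma spanning_tree_size T T' : ost T -> ost T' -> size T = size T'.
Proof.
move=> oT oT'; have [[UT sT nT _] [UT' sT' nT' _]] := (oT, oT').
by apply/eqP; rewrite eqn_leq !acyclic_size_le.
Qed.

Lemma kruskal_spanning_tree es :
  {in N &, forall x y, connect (edge_rel (enum E)) x y} ->
  es =i E -> uniq es -> ost (kruskal es).
Proof.
move=> cE esE Ues; have [UK sK nK] := kruskal_uniq_sub Ues; split=> //.
  by move=> r /sK; rewrite esE.
move=> x y xN yN; apply: connect_sub (cE x y xN yN) => {xN yN} {}x {}y.
rewrite /edge_rel mem_enum => xyE.
have [xyK|xyK] := boolP ([set x; y]%SET \in kruskal es); first exact: connect1.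
by apply: has_cycle_connect => //; apply: kruskal_maximal => //; rewrite esE.
Qed.

(* Both trees pick a minimal element at each step, hence the same one. *)
Lemma greedy_for_unique (le : rel {set V}) T T' : ost T -> ost T' ->
  {in T & E, forall r s, le r s -> le s r -> r = s} ->
  greedy_for E le T -> greedy_for E le T' -> T = T'.
Proof.
move=> oT oT' le_anti gT gT'; have szT := spanning_tree_size oT oT'.
have [[UT sT nT _] [UT' sT' nT' _]] := (oT, oT').
suff tk k : (k <= size T)%N -> take k T = take k T'.
  by move: (tk _ (leqnn _)); rewrite {2}szT !take_size.
elim: k => [|k IH] kT; first by rewrite !take0.
have kT' : (k < size T')%N by rewrite -szT.
have tE := IH (ltnW kT).
have ok (U : seq {set V}) : uniq U -> ~ has_cycle U -> (k < size U)%N ->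
    nth finset.set0 U k \notin take k U /\
    ~ has_cycle (rcons (take k U) (nth finset.set0 U k)).
  move=> UU nU kU; rewrite -take_nth //; split.
    have := take_uniq k.+1 UU; rewrite (take_nth finset.set0) // rcons_uniq.
    by case/andP.
  exact: (acyclic_take nU).
have [a1 b1] := ok _ UT nT kT; have [a2 b2] := ok _ UT' nT' kT'.
rewrite !(take_nth finset.set0) // tE; congr rcons; apply: le_anti.
- exact: mem_nth.
- by apply: sT'; apply: mem_nth.
- by apply: gT => //; [apply: sT'; apply: mem_nth|rewrite tE|rewrite tE].
by apply: gT' => //; [apply: sT; apply: mem_nth|rewrite -tE|rewrite -tE].
Qed.

Variable R : realType.
Implicit Type w : {set V} -> R.

Definition weight_le w : rel {set V} := fun r s => w r <= w s.

Lemma greedy_outputP w T :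
  {in N &, forall x y, connect (edge_rel (enum E)) x y} ->
  greedy_output E w T <-> ost T /\ greedy_for E (weight_le w) T.
Proof.
move=> cE; split.
  move=> [es [pes ses <-]]; have esE : es =i E.
    by move=> r; rewrite (perm_mem pes) mem_enum.
  have Ues : uniq es by rewrite (perm_uniq pes) enum_uniq.
  split; first exact: kruskal_spanning_tree.
  apply: kruskal_greedy ses esE Ues => [r|r s t]; first exact: lexx.
  exact: le_trans.
move=> [oT gT]; have [UT sT nT _] := oT.
pose le r s := (w r < w s) || ((w r == w s) && (index r T <= index s T)%N).
have le_refl : reflexive le by move=> r; rewrite /le eqxx leqnn orbT.
have le_tr : transitive le.
  move=> s r t /orP[rs|/andP[/eqP rs irs]] /orP[st|/andP[/eqP st ist]]; apply/orP.
  - by left; apply: lt_trans rs st.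
  - by left; rewrite -st.
  - by left; rewrite rs.
  by right; rewrite rs st eqxx (leq_trans irs).
have le_tot : total le.
  by move=> r s; rewrite /le; case: ltgtP => //= _; apply: leq_total.
pose es := sort le (enum E).
have pes : perm_eq es (enum E) by rewrite perm_sort.
have esE : es =i E by move=> r; rewrite (perm_mem pes) mem_enum.
have Ues : uniq es by rewrite (perm_uniq pes) enum_uniq.
have ses : sorted le es by apply: sort_sorted.
exists es; split=> //.
  apply: sub_sorted ses => r s /orP[/ltW//|/andP[/eqP-> _]]; exact: lexx.
apply/esym/(greedy_for_unique (le := le)) => //.
- exact: kruskal_spanning_tree.
- move=> r s rT sE /orP[rs|/andP[/eqP rs irs]] /orP[sr|/andP[/eqP sr isr]].
  + by have := lt_trans rs sr; rewrite ltxx.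
  + by rewrite sr ltxx in rs.
  + by rewrite rs ltxx in sr.
  have iE : index r T = index s T by apply/eqP; rewrite eqn_leq irs.
  have sT' : s \in T by rewrite -index_mem -iE index_mem.
  by rewrite -(nth_index finset.set0 rT) iE nth_index.
- move=> i r iT rE rt nr; apply/orP; have := gT i r iT rE rt nr.
  rewrite /weight_le le_eqVlt => /orP[/eqP wE|]; [right|by left].
  rewrite wE eqxx /= index_uniq // leqNgt; apply: contra rt => ir.
  have rT : r \in T by rewrite -index_mem (ltn_trans ir).
  rewrite -(nth_index finset.set0 rT) -(nth_take _ ir); apply: mem_nth.
  by rewrite size_take iT.
exact: kruskal_greedy.
Qed.

Lemma greedy_prefix_min w T I : ost T -> greedy_for E (weight_le w) T ->
  uniq I -> {subset I <= E} -> ~ has_cycle I ->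
  \sum_(e <- take (size I) T) w e <= \sum_(e <- I) w e.
Proof.
move=> oT gT; have [UT sT nT _] := oT.
move kE : (size I) => k; elim: k I kE => [|k IH] I kE UI sI nI.
  by rewrite take0 (size0nil kE) lexx.
have kT : (k < size T)%N by rewrite -kE; apply: acyclic_size_le oT _ _ _.
have sk : {subset take k T <= E} by move=> e /mem_take /sT.
have nk := acyclic_take (k := k) nT.
have [e [eI ek ne]] : exists e, [/\ e \in I, e \notin take k T
    & ~ has_cycle (rcons (take k T) e)].
  apply: acyclic_augment; rewrite ?size_take ?kT ?kE //; exact: sub_card2.
rewrite (take_nth finset.set0) // -cats1 big_cat big_seq1 /=.
rewrite (perm_big _ (perm_to_rem eI)) big_cons /= addrC.
apply: lerD; first by apply: gT => //; apply: sI.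
apply: IH; rewrite ?rem_uniq ?size_rem ?kE //; first by move=> r /mem_rem /sI.
by move=> cI; apply/nI/(has_cycle_sub _ cI) => r /mem_rem.
Qed.

(* Each summand is separately minimal for a greedy tree. *)
Definition flag_weight w T : R :=
  \sum_(k < (size T).+1) \sum_(e <- take k T) w e.

Lemma flag_weight_le w T T' : ost T -> greedy_for E (weight_le w) T ->
  ost T' -> flag_weight w T <= flag_weight w T'.
Proof.
move=> oT gT oT'; rewrite /flag_weight (spanning_tree_size oT oT').
apply: ler_sum => k _; have [UT' sT' nT' _] := oT'.
have szk : size (take k T') = k by rewrite size_takel // -ltnS.
rewrite -{1}szk; apply: greedy_prefix_min => //; first exact: take_uniq.
  by move=> e /mem_take /sT'.
exact: (acyclic_take nT').
Qed.

Lemma flag_weight_eq w T T' : ost T -> greedy_for E (weight_le w) T ->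
  ost T' -> flag_weight w T' = flag_weight w T -> greedy_for E (weight_le w) T'.
Proof.
move=> oT gT oT' /eqP; have [UT' sT' nT' _] := oT'.
have szT := spanning_tree_size oT oT'.
have nk k := acyclic_take (k := k) nT'.
have sk k : {subset take k T' <= E} by move=> e /mem_take /sT'.
rewrite /flag_weight szT -subr_eq0 -sumrB psumr_eq0 => [|k _]; last first.
  rewrite subr_ge0; have szk : size (take k T') = k by rewrite size_takel // -ltnS.
  by rewrite -{1}szk; apply: greedy_prefix_min => //; apply: take_uniq.
move=> /allP eqk i r iT' rE rt nr.
have eqs k : (k <= size T')%N ->
    \sum_(e <- take k T') w e = \sum_(e <- take k T) w e.
  move=> kT'; have kT : (k < (size T').+1)%N by rewrite ltnS.
  have := eqk (Ordinal kT) (mem_index_enum _).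
  by rewrite /= subr_eq0 => /eqP.
have szr : size (rcons (take i T') r) = i.+1 by rewrite size_rcons size_takel // ltnW.
have : \sum_(e <- take i.+1 T) w e <= \sum_(e <- rcons (take i T') r) w e.
  rewrite -{1}szr; apply: greedy_prefix_min => //.
    by rewrite rcons_uniq rt take_uniq.
  by move=> e; rewrite mem_rcons inE => /orP[/eqP->//|/sk].
rewrite -eqs // (take_nth finset.set0) // -!cats1 !big_cat !big_seq1 /=.
by rewrite lerD2l.
Qed.

End SpanningTrees.
End Forests.

(** * Polyhedral cones *)

Section Cones.
Local Open Scope classical_set_scope.
Variables (R : realType) (m : nat).
Implicit Types (x y g : 'rV[R]_m) (c : 'cV[R]_m) (C D E : set 'rV[R]_m).

Lemma dotp_ray x y t c : dotp (x + t *: y) c = dotp x c + t * dotp y c.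
Proof. by rewrite mulmxDl -scalemxAl [LHS]mxE [X in _ + X = _]mxE. Qed.

Lemma dotp_rayN x y t c : dotp (x + t *: - y) c = dotp x c - t * dotp y c.
Proof. by rewrite dotp_ray mulNmx [X in _ + _ * X]mxE mulrN. Qed.

Lemma near_right_gt0 (u v : R) : 0 < u -> \forall t \near 0^'+, 0 < u + t * v.
Proof.
move=> u0; have v1 : 0 < `|v| + 1 by rewrite ltr_wpDl.
near=> t; have t0 : 0 < t by near: t; exact: nbhs_right_gt.
have : t < u / (`|v| + 1) by near: t; apply: nbhs_right_lt; rewrite divr_gt0.
rewrite ltr_pdivlMr // mulrDr mulr1 => tu.
have : - (t * `|v|) <= t * v by rewrite -mulrN ler_pM2l // lerNnormlW.
lra.
Unshelve. all: by end_near. Qed.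

Lemma near_right_neq0 (u v : R) : u != 0 \/ v != 0 ->
  \forall t \near 0^'+, u + t * v != 0.
Proof.
move=> uv; case: (ltgtP u 0) => [u0|u0|uE].
- have := @near_right_gt0 (- u) (- v); rewrite oppr_gt0 => /(_ u0).
  by apply: filterS => t; rewrite mulrN -opprD oppr_gt0 => /lt_eqF->.
- by apply: filterS (near_right_gt0 v u0) => t /gt_eqF->.
apply: filterS (nbhs_right_gt (0 : R)) => t t0.
by rewrite uE add0r mulf_neq0 ?(gt_eqF t0) //; case: uv; rewrite ?uE ?eqxx.
Qed.

Lemma near_right_cvg x y (B : set 'rV[R]_m) : nbhs x B ->
  \forall t \near 0^'+, B (x + t *: y).
Proof.
move=> /nbhs_ballP[e /= e0 xB].
have : \forall t \near 0^'+, forall j : 'I_m,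
    0 < e + t * - y 0 j /\ 0 < e + t * y 0 j.
  by apply: filter_forall => j; apply: filterI; apply: near_right_gt0.
apply: filterS => t te; apply: xB; split=> // i j.
rewrite !mxE (ord1 i) /ball /= opprD addrA subrr add0r normrN ltr_norml.
by have [] := te j; rewrite mulrN => ? ?; apply/andP; split; lra.
Qed.

Lemma closure_right C x y : (\forall t \near 0^'+, C (x + t *: y)) -> closure C x.
Proof.
move=> Cxy B /(near_right_cvg y) Bxy.
by have [t [Ct Bt]] := filter_ex (filterI Cxy Bxy); exists (x + t *: y).
Qed.

Lemma dotp_continuous c : continuous (fun x => dotp x c).
Proof.
have -> : (fun x => dotp x c) = fun x : 'rV[R]_m => \sum_j x 0 j * c j 0.
  by apply/funext => z; rewrite mxE.
apply: continuous_big => [|j _ x]; first exact: add_continuous.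
by have /cvgM := @coord_continuous R 1 m 0 j x; apply; apply: cvg_cst.
Qed.

Lemma closure_halfspace C c : (forall x, C x -> 0 <= dotp x c) ->
  forall x, closure C x -> 0 <= dotp x c.
Proof.
move=> Cc x Cx.
have clH : closed ((fun z : 'rV[R]_m => dotp z c) @^-1` [set r | 0 <= r]).
  apply: preimage_closed; last exact: closed_ge.
  by move=> z _; apply: dotp_continuous.
rewrite closureE in Cx; exact: (Cx _ (conj clH Cc)).
Qed.

Definition halfspaces (I : finType) (b : I -> 'cV[R]_m) : set 'rV[R]_m :=
  [set x | forall i, 0 <= dotp x (b i)].

Lemma halfspaces_polyhedral (I : finType) (b : I -> 'cV[R]_m) :
  polyhedral_cone (halfspaces b).
Proof.
exists #|I|, (\matrix_(i, j) b (enum_val j) i 0).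
have E x j : (x *m (\matrix_(i, j) b (enum_val j) i 0)) 0 j =
    dotp x (b (enum_val j)).
  by rewrite !mxE; apply: eq_bigr => i _; rewrite mxE.
apply/seteqP; split=> x /= bx i; first by rewrite E.
by rewrite -(enum_rankK i) -E.
Qed.

Lemma polyhedralP C : polyhedral_cone C ->
  exists (I : finType) (b : I -> 'cV[R]_m), C = halfspaces b.
Proof.
move=> [k [B ->]]; exists 'I_k, (fun j => col j B).
have E x j : (x *m B) 0 j = dotp x (col j B).
  by rewrite !mxE; apply: eq_bigr => i _; rewrite mxE.
by apply/seteqP; split=> x /= bx i; move: (bx i); rewrite E.
Qed.

Lemma cone_face_sub C D : cone_face C D -> D `<=` C.
Proof. by move=> [c [_ ->]] x []. Qed.

Lemma cone_face_refl C : cone_face C C.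
Proof.
exists 0; split; first by move=> x _; rewrite mulmx0 mxE.
by apply/seteqP; split=> [x Cx|x []//]; rewrite /= mulmx0 mxE.
Qed.

Lemma cone_face_subset C D E : cone_face C E -> E `<=` D -> D `<=` C ->
  cone_face D E.
Proof.
move=> [c [c0 EE]] ED DC; exists c; split; first by move=> x /DC; apply: c0.
apply/seteqP; split=> [x Ex|x [/DC Cx cx]]; last by rewrite EE.
by split; [apply: ED|move: Ex; rewrite EE => -[]].
Qed.

Lemma cone_face_halfspaces (I : finType) (b : I -> 'cV[R]_m) c :
  (forall x, halfspaces b x -> 0 <= dotp x c) ->
  [set x | halfspaces b x /\ dotp x c = 0] =
  halfspaces (fun o : option I => if o is Some i then b i else - c).
Proof.
move=> c0; apply/seteqP; split=> [x [bx cx] [i|]|x bx].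
- exact: bx.
- by rewrite mulmxN mxE cx oppr0.
have bx' : halfspaces b x by move=> i; apply: (bx (Some i)).
split=> //; apply/eqP; rewrite eq_le c0 // andbT.
by have := bx None; rewrite mulmxN mxE oppr_ge0.
Qed.

Lemma cone_face_polyhedral C D : polyhedral_cone C -> cone_face C D ->
  polyhedral_cone D.
Proof.
move=> /polyhedralP[I [b ->]] [c [c0 ->]].
by rewrite cone_face_halfspaces //; apply: halfspaces_polyhedral.
Qed.

(* Moving from a relative interior point of the face away from x stays in the
   cone, hence the functional c exposing the face cannot be positive at x. *)
Lemma cone_face_active (I : finType) (b : I -> 'cV[R]_m) D :
  cone_face (halfspaces b) D ->
  exists J : {set I},
    D = [set x | halfspaces b x /\ forall j, j \in J -> dotp x (b j) = 0].
Proof.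
move=> [c [c0 DE]].
pose J : {set I} := [set j | `[< forall x, D x -> dotp x (b j) = 0 >]]%SET.
have D0 : D 0 by rewrite DE; split=> [i|]; rewrite mul0mx mxE.
have DD x y : D x -> D y -> D (x + y).
  rewrite DE => -[bx cx] [b_y cy]; split=> [i|]; rewrite mulmxDl mxE.
    by rewrite addr_ge0.
  by rewrite cx cy addr0.
have /choice[z zP] : forall j, exists z, D z /\ (j \notin J -> 0 < dotp z (b j)).
  move=> j; have [jJ|jJ] := boolP (j \in J); first by exists 0.
  move: jJ; rewrite inE => /asboolPn/existsNP[z /not_implyP[Dz /eqP zj]].
  exists z; split=> // _; rewrite lt_def zj /=.
  by move: Dz; rewrite DE => -[bz _]; apply: bz.
pose y := \sum_j z j.
have Dy : D y by rewrite /y; elim/big_ind: _ => // j _; case: (zP j).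
have yJ j : j \notin J -> 0 < dotp y (b j).
  move=> jJ; rewrite /y mulmx_suml summxE (bigD1 j) //=.
  apply: ltr_pwDl; first by have [_ ->] := zP j.
  apply: sumr_ge0 => k _; have [+ _] := zP k; rewrite DE => -[bz _]; exact: bz.
exists J; apply/seteqP; split=> x.
  move=> Dx; split; first by move: Dx; rewrite DE => -[].
  by move=> j; rewrite inE => /asboolP; apply.
move=> [bx xJ]; rewrite DE; split=> //; apply/eqP; rewrite eq_le c0 // andbT.
have nb : \forall t \near 0^'+, halfspaces b (y + t *: (- x)).
  apply: filter_forall => j; have [jJ|jJ] := boolP (j \in J).
    near=> t; rewrite dotp_rayN xJ // mulr0 subr0.
    by move: Dy; rewrite DE => -[by_ _]; apply: by_.
  have := near_right_gt0 (- dotp x (b j)) (yJ j jJ).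
  by apply: filterS => t /ltW; rewrite dotp_rayN mulrN.
have [t [t0 /c0]] := filter_ex (filterI (nbhs_right_gt (0 : R)) nb).
have cy : dotp y c = 0 by move: Dy; rewrite DE => -[].
by rewrite dotp_rayN cy add0r oppr_ge0 pmulr_rle0.
Unshelve. all: by end_near. Qed.

Lemma finite_faces C : polyhedral_cone C -> finite_set [set D | cone_face C D].
Proof.
move=> /polyhedralP[I [b ->]].
pose f (J : {set I}) := [set x | halfspaces b x /\
  forall j, j \in J -> dotp x (b j) = 0].
apply: (@sub_finite_set _ _ (f @` setT)).
  by move=> D /cone_face_active[J ->]; exists J.
exact: finite_image.
Qed.

Lemma cone_face_trans C D E : polyhedral_cone C -> cone_face C D ->
  cone_face D E -> cone_face C E.
Proof.
move=> /polyhedralP[I [b ->]] [c [c0 ->]].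
rewrite cone_face_halfspaces // => /cone_face_active[J ->].
rewrite -cone_face_halfspaces //.
pose c' := c + \sum_(i | Some i \in J) b i.
have c'E x : dotp x c' = dotp x c + \sum_(i | Some i \in J) dotp x (b i).
  by rewrite mulmxDr mxE mulmx_sumr summxE.
have s0 x : halfspaces b x -> 0 <= \sum_(i | Some i \in J) dotp x (b i).
  by move=> bx; apply: sumr_ge0 => i _; apply: bx.
exists c'; split=> [x bx|]; first by rewrite c'E addr_ge0 ?c0 ?s0.
apply/seteqP; split=> x /=.
  move=> [[bx cx] bJ]; split=> //; rewrite c'E cx add0r big1 // => i iJ.
  exact: bJ iJ.
move=> [bx]; rewrite c'E => /eqP.
rewrite paddr_eq0 ?c0 ?s0 // => /andP[/eqP cx].
rewrite psumr_eq0 => [/allP sx|i _]; last exact: bx.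
split=> // -[i|] iJ; last by rewrite mulmxN mxE cx oppr0.
by have /implyP/(_ iJ)/eqP := sx i (mem_index_enum i).
Qed.

Lemma cone_face_inter C D F G : polyhedral_cone C -> cone_face C (C `&` D) ->
  cone_face C F -> cone_face D G -> cone_face F (F `&` G).
Proof.
move=> pC CD CF DG; apply: (cone_face_subset (C := C)); last 2 first.
- by move=> x [].
- exact: cone_face_sub.
apply: (cone_face_trans pC CD).
move: CF DG => [c [c0 ->]] [d [d0 ->]]; exists (c + d).
have E x : dotp x (c + d) = dotp x c + dotp x d by rewrite mulmxDr mxE.
split=> [x [Cx Dx]|]; first by rewrite E addr_ge0 ?c0 ?d0.
apply/seteqP; split=> x /=.
  by move=> [[Cx cx] [Dx dx]]; rewrite E cx dx addr0.
move=> [[Cx Dx]]; rewrite E => /eqP; rewrite paddr_eq0 ?c0 ?d0 //.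
by move=> /andP[/eqP-> /eqP->].
Qed.

Definition absorbing C g : Prop := forall v, \forall t \near 0^'+, C (g + t *: v).

Lemma absorbing_face C D g : cone_face C D -> absorbing D g -> D = C.
Proof.
move=> CD Dg; apply/seteqP; split; first exact: cone_face_sub.
move: CD Dg => [c [c0 ->]] Dg x Cx; split=> //.
have [t [t0 [_]]] := filter_ex (filterI (nbhs_right_gt (0 : R)) (Dg x)).
have [t' [_]] := filter_ex (Dg 0).
rewrite scaler0 addr0 dotp_ray => ->; rewrite add0r => /eqP.
by rewrite mulf_eq0 gt_eqF //= => /eqP.
Qed.

Lemma absorbing_cone_dim C g : absorbing C g -> cone_dim C m.
Proof.
move=> Cg.
have nC : \forall t \near 0^'+, forall i : 'I_m, C (g + t *: delta_mx 0 i).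
  by apply: filter_forall => i; apply: Cg.
have ns : \forall t \near 0^'+, \sum_j g 0 j + t * 1 != 0.
  by apply: near_right_neq0; right; rewrite oner_eq0.
have [t [t0 [nCt]]] := filter_ex
  (filterI (nbhs_right_gt (0 : R)) (filterI nC ns)).
rewrite mulr1 => st; pose B : 'M[R]_m := \matrix_i (g + t *: delta_mx 0 i).
have BE i j : B i j = g 0 j + t * (j == i)%:R by rewrite !mxE.
have Bfree : row_free B.
  rewrite -kermx_eq0; apply/rowV0P => u /sub_kermxP uB.
  have uE j : (\sum_i u 0 i) * g 0 j + t * u 0 j = 0.
    have /matrixP/(_ 0 j) := uB; rewrite !mxE.
    under eq_bigr do rewrite BE mulrDr.
    rewrite big_split /= -mulr_suml [X in _ + X](bigD1 j) //= eqxx mulr1.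
    rewrite [X in _ + (_ + X)]big1 ?addr0 => [|i ij]; first by rewrite [u 0 j * t]mulrC.
    by rewrite eq_sym (negbTE ij) mulr0 mulr0.
  have s0 : \sum_i u 0 i = 0.
    have : \sum_j ((\sum_i u 0 i) * g 0 j + t * u 0 j) = 0 by apply: big1.
    rewrite big_split /= -!mulr_sumr [t * _]mulrC -mulrDr => /eqP.
    by rewrite mulf_eq0 (negbTE st) orbF => /eqP.
  apply/rowP => j; rewrite mxE; have /eqP := uE j; rewrite s0 mul0r add0r.
  by rewrite mulf_eq0 gt_eqF //= => /eqP.
exists B; split=> // [i|x _]; first by rewrite rowK.
by apply: submx_full; rewrite row_full_unit -row_free_unit.
Qed.

End Cones.

(** * Affine functions and maximal cells *)

Section AffineFunctions.
Variables (R : realType) (m n : nat) (a : 'I_m -> 'rV[R]_n).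
Implicit Types (g : 'rV[R]_m) (l d : 'cV[R]_(1 + n)) (S F : {set 'I_m}).

(* The column l encodes the affine function x |-> hom x *m l. *)
Definition ev l (i : 'I_m) : R := (hom (a i) *m l) 0 0.

Lemma eq_ev l i j : a i = a j -> ev l i = ev l j.
Proof. by rewrite /ev => ->. Qed.

Lemma evD l d i : ev (l + d) i = ev l i + ev d i.
Proof. by rewrite /ev mulmxDr mxE. Qed.

Lemma evZ c l i : ev (c *: l) i = c * ev l i.
Proof. by rewrite /ev -scalemxAr mxE. Qed.

Lemma evN l i : ev (- l) i = - ev l i.
Proof. by rewrite /ev mulmxN mxE. Qed.

Lemma ev_sum (I : Type) (r : seq I) (P : pred I) (F : I -> 'cV[R]_(1 + n)) i :
  ev (\sum_(j <- r | P j) F j) i = \sum_(j <- r | P j) ev (F j) i.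
Proof. by rewrite /ev mulmx_sumr summxE. Qed.

Lemma ev_col_mx (c : 'M[R]_1) v i : ev (col_mx c v) i = c 0 0 + (a i *m v) 0 0.
Proof.
rewrite /ev /hom mul_row_col mxE; congr (_ + _).
by rewrite mxE big_ord1 mxE mul1r.
Qed.

Definition points S : 'M[R]_(m, 1 + n) :=
  \matrix_(i < m) (if i \in S then hom (a i) else 0).

Lemma row_points S i : row i (points S) = if i \in S then hom (a i) else 0.
Proof. exact: rowK. Qed.

Lemma points_ev0 S l : points S *m l = 0 <-> {in S, forall i, ev l i = 0}.
Proof.
split=> [Sl i iS|Sl].
  have /(congr1 (row i)) := Sl; rewrite row_mul row_points iS row0.
  by move=> /matrixP/(_ 0 0); rewrite [RHS]mxE.
apply/row_matrixP => i; rewrite row_mul row_points row0.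
case: ifP => iS; last by rewrite mul0mx.
by apply/matrixP => p q; rewrite !ord1 [RHS]mxE; apply: Sl.
Qed.

Lemma affrank_ev0 S l : affrank a S = n.+1 -> {in S, forall i, ev l i = 0} -> l = 0.
Proof.
move=> rS /points_ev0 Sl.
have /row_fullP[B BS] : row_full (points S) by rewrite /row_full [\rank _]rS.
by rewrite -[l]mul1mx -BS -mulmxA Sl mulmx0.
Qed.

Lemma affrank_le S : (affrank a S <= n.+1)%N.
Proof. exact: (rank_leq_col (points S)). Qed.

Lemma affrank_ker S : (affrank a S < n.+1)%N ->
  exists2 l, l != 0 & {in S, forall i, ev l i = 0}.
Proof.
move=> rS; have : cokermx (points S) != 0.
  by rewrite cokermx_eq0 /row_full neq_ltn [(_ < _)%N]rS.
move=> /matrix0Pn[i [j ij]]; exists (col j (cokermx (points S))).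
  by apply/matrix0Pn; exists i, 0; rewrite mxE.
by apply/points_ev0; rewrite colE mulmxA mulmx_coker mul0mx.
Qed.

Lemma affrank_sub S S' : S \subset S' -> (points S <= points S')%MS.
Proof.
move=> /fintype.subsetP SS'; apply/row_subP => i; rewrite row_points.
case: ifP => iS; last exact: sub0mx.
by have := row_sub i (points S'); rewrite row_points (SS' _ iS).
Qed.

Lemma affrankU S S' : (affrank a (S :|: S') <= affrank a S + affrank a S')%N.
Proof.
apply: leq_trans (mxrank_adds_leqif (points S) (points S')).1.
apply: mxrankS; apply/row_subP => i; rewrite row_points inE.
have rs S0 : i \in S0 -> (hom (a i) <= points S0)%MS.
  by move=> iS; have := row_sub i (points S0); rewrite row_points iS.
case: ifP => [/orP[]/rs iS|_]; last exact: sub0mx.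
- exact: submx_trans iS (addsmxSl _ _).
exact: submx_trans iS (addsmxSr _ _).
Qed.

Lemma affrank1 i : (affrank a [set i] <= 1)%N.
Proof.
apply: leq_trans (mxrankS (B := hom (a i)) _) (rank_leq_row _).
apply/row_subP => j; rewrite row_points inE.
by case: eqP => [->|_]; rewrite ?submx_refl ?sub0mx.
Qed.

Lemma affrank0 : affrank a finset.set0 = 0%N.
Proof.
apply/eqP; rewrite mxrank_eq0; apply/eqP/row_matrixP => i.
by rewrite row_points inE row0.
Qed.

Lemma affrank_card S : (affrank a S <= #|S|)%N.
Proof.
move: {2}#|S| (erefl #|S|) => k; elim: k S => [|k IH] S Sk.
  by move/eqP: (Sk); rewrite cards_eq0 => /eqP->; rewrite affrank0.
have [i iS] : exists i, i \in S by apply/card_gt0P; rewrite Sk.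
have ck : #|S :\ i| = k by apply/eqP; rewrite -eqSS -Sk (cardsD1 i S) iS.
rewrite Sk -(finset.setD1K iS); apply: leq_trans (affrankU _ _) _.
by rewrite -[k.+1]add1n leq_add ?affrank1 // -ck; apply: IH.
Qed.

Definition tight g l : {set 'I_m} := [set i | g 0 i == ev l i]%SET.
Definition dominates l g : Prop := forall i, g 0 i <= ev l i.

Lemma affrank_lift g l S : {in S, forall i, g 0 i = ev l i} ->
  affrank (lift_pt a g) S = affrank a S.
Proof.
move=> gl; set l0 := usubmx l; set v := dsubmx l.
pose K : 'M[R]_(1 + n, 1 + (n + 1)) :=
  col_mx (row_mx 1%:M (row_mx 0 l0)) (row_mx 0 (row_mx 1%:M v)).
pose P : 'M[R]_(1 + (n + 1), 1 + n) :=
  col_mx (row_mx 1%:M 0) (col_mx (row_mx 0 1%:M) 0).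
have KP : K *m P = 1%:M.
  rewrite /K /P mul_col_mx !mul_row_col.
  by rewrite !(mul1mx, mul0mx, mulmx0, addr0, add0r) (scalar_mx_block 1 n).
have Kfree : row_free K by apply/row_freeP; exists P.
rewrite /affrank -(mxrankMfree _ Kfree); congr (\rank _).
apply/row_matrixP => i; rewrite row_mul !rowK.
case: ifP => iS; last by rewrite mul0mx.
have c1 : const_mx 1 = 1%:M :> 'M[R]_1.
  by apply/matrixP => p q; rewrite !ord1 !mxE.
have evi : (g 0 i)%:M = l0 + a i *m v :> 'M[R]_1.
  apply/matrixP => p q; rewrite !ord1 mxE eqxx mulr1n gl // -[l]vsubmxK ev_col_mx.
  by rewrite [RHS]mxE.
rewrite /hom /lift_pt /K mul_row_col c1 !mul1mx !mul_mx_row mulmx0 mulmx1.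
by rewrite !add_row_mx addr0 add0r evi.
Qed.

Lemma mx11_tr (A : 'M[R]_1) : A^T = A.
Proof. by apply/matrixP => p q; rewrite !ord1 mxE. Qed.

Lemma lift_value g (b : 'rV[R]_n) t i :
  (row_mx b t%:M *m (lift_pt a g i)^T) 0 0 = (a i *m b^T) 0 0 + t * g 0 i.
Proof.
rewrite /lift_pt tr_row_mx mul_row_col mxE; congr (_ + _).
  by rewrite -[b *m _]mx11_tr trmx_mul trmxK.
by rewrite mx11_tr -scalar_mxM mxE eqxx mulr1n.
Qed.

Lemma SigmaP g S : S \in Sigma a g <->
  exists l, [/\ dominates l g, S = tight g l & affrank a S = n.+1].
Proof.
rewrite inE; split.
  move=> /asboolP[b [t [t0 SE rS]]].
  have [i0 i0S] : exists i, i \in S.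
    apply/card_gt0P; rewrite lt0n cards_eq0; apply/eqP => S0.
    move: rS; rewrite S0 => r0.
    suff : affrank (lift_pt a g) finset.set0 = 0%N by rewrite r0.
    by apply/eqP; rewrite mxrank_eq0; apply/eqP/row_matrixP => i; rewrite rowK inE row0.
  pose M := (a i0 *m b^T) 0 0 + t * g 0 i0.
  have Mmax j : (a j *m b^T) 0 0 + t * g 0 j <= M.
    move: i0S; rewrite SE inE => /andP[_ /forallP/(_ j)].
    by rewrite !lift_value inE.
  pose l : 'cV[R]_(1 + n) := col_mx (M / t)%:M (- t^-1 *: b^T).
  have tn0 : t != 0 by rewrite gt_eqF.
  have lE i : t * (ev l i - g 0 i) = M - ((a i *m b^T) 0 0 + t * g 0 i).
    have -> : ev l i = M / t - t^-1 * (a i *m b^T) 0 0.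
      by rewrite ev_col_mx -scalemxAr mxE eqxx mulr1n -mulNr [in LHS]mxE.
    by field.
  have dom : dominates l g.
    by move=> i; rewrite -subr_ge0 -(pmulr_rge0 _ t0) lE subr_ge0.
  have ST : S = tight g l.
    apply/setP => i; rewrite [i \in tight _ _]inE.
    have -> : (g 0 i == ev l i) = ((a i *m b^T) 0 0 + t * g 0 i == M).
      rewrite -[RHS]subr_eq0 -oppr_eq0 opprB -lE mulf_eq0 (negbTE tn0) /=.
      by rewrite subr_eq0 eq_sym.
    rewrite SE !inE /=; apply/forallP/eqP => [iP|iM j].
      by apply/eqP; rewrite eq_le Mmax /=; have := iP i0; rewrite !lift_value inE.
    by rewrite inE /= !lift_value iM.
  exists l; split=> //; rewrite -rS; apply/esym/(affrank_lift (l := l)).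
  by move=> i; rewrite ST inE => /eqP.
move=> [l [dom ST rS]]; apply/asboolP; exists (- (dsubmx l)^T), 1; split=> //.
- have [i0 i0S] : exists i, i \in S.
    apply/card_gt0P; rewrite lt0n cards_eq0; apply/eqP => S0.
    by move: rS; rewrite S0 affrank0.
  have vE i : (row_mx (- (dsubmx l)^T) 1%:M *m (lift_pt a g i)^T) 0 0
      = usubmx l 0 0 - (ev l i - g 0 i).
    rewrite lift_value -[in ev l i](vsubmxK l) ev_col_mx raddfN /= trmxK mulmxN mxE.
    ring.
  apply/setP => i; rewrite ST !inE /=; apply/eqP/forallP => [gi j|iP].
    by rewrite inE /= !vE gi subrr lerB // subr_ge0 dom.
  apply/eqP; rewrite eq_le dom /=; have := iP i0; rewrite inE /= !vE.
  have : ev l i0 = g 0 i0 by move: i0S; rewrite ST inE => /eqP.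
  by move=> ->; lra.
by rewrite -rS; apply: (affrank_lift (l := l)) => i; rewrite ST inE => /eqP.
Qed.

Definition simplex S : Prop := affrank a S = n.+1 /\ #|S| = n.+1.

Definition is_dual S (D : 'M[R]_(1 + n, m)) : Prop :=
  forall i j, i \in S -> j \in S -> ev (col i D) j = (i == j)%:R.

Lemma is_dual_exists S : simplex S -> exists D, is_dual S D.
Proof.
move=> [rS cS].
have /choice[d dP] : forall i, exists d, i \in S ->
    {in S, forall j, ev d j = (i == j)%:R}.
  move=> i; have [iS|iS] := boolP (i \in S); last by exists 0.
  have : (affrank a (S :\ i) < n.+1)%N.
    by apply: leq_ltn_trans (affrank_card _) _; rewrite -cS (cardsD1 i S) iS.
  move=> /affrank_ker[l l0 lS].
  have li : ev l i != 0.
    apply: contraNneq l0 => li; apply/eqP; apply: (affrank_ev0 rS) => j jS.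
    by case: (eqVneq j i) => [->//|ji]; apply: lS; rewrite !inE ji.
  exists ((ev l i)^-1 *: l) => _ j jS; rewrite evZ.
  case: (eqVneq i j) => [<-|ij]; first by rewrite mulVf.
  by rewrite (lS j) ?mulr0 // !inE eq_sym ij.
exists (\matrix_(p, i) d i p 0) => i j iS jS.
rewrite -(dP i iS j jS); congr (ev _ _).
by apply/matrixP => p q; rewrite !ord1 !mxE.
Qed.

Definition dual S : 'M[R]_(1 + n, m) := xget 0 [set D | is_dual S D]%classic.

Lemma dualE S i j : simplex S -> i \in S -> j \in S ->
  ev (col i (dual S)) j = (i == j)%:R.
Proof. by move=> /is_dual_exists[D DS]; apply: (xgetI 0 DS). Qed.

Definition interp S g : 'cV[R]_(1 + n) := \sum_(i in S) g 0 i *: col i (dual S).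

Lemma ev_interp S g j : simplex S -> j \in S -> ev (interp S g) j = g 0 j.
Proof.
move=> sS jS; rewrite ev_sum (bigD1 j) //= evZ dualE // eqxx mulr1 big1 ?addr0 //.
by move=> i /andP[iS ij]; rewrite evZ dualE // (negbTE ij) mulr0.
Qed.

Lemma interp_unique S g l : simplex S -> {in S, forall j, ev l j = g 0 j} ->
  l = interp S g.
Proof.
move=> sS lS; apply/eqP; rewrite -subr_eq0; apply/eqP.
apply: (affrank_ev0 sS.1) => j jS.
by rewrite evD evN ev_interp // lS // subrr.
Qed.

Definition gap S j : 'cV[R]_m :=
  \col_i ((i \in S)%:R * ev (col i (dual S)) j - (i == j)%:R).

Lemma gapE S g j : dotp g (gap S j) = ev (interp S g) j - g 0 j.
Proof.
rewrite mxE; under eq_bigr do rewrite mxE mulrBr.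
rewrite sumrB; congr (_ - _).
  rewrite ev_sum [RHS]big_mkcond /=; apply: eq_bigr => i _.
  by case: ifP => _; rewrite ?evZ ?mul1r // mul0r mulr0.
rewrite (bigD1 j) //= eqxx mulr1 big1 ?addr0 // => i /negbTE->.
by rewrite mulr0.
Qed.

Lemma gap_in S g j : simplex S -> j \in S -> dotp g (gap S j) = 0.
Proof. by move=> sS jS; rewrite gapE ev_interp // subrr. Qed.

Lemma Sigma_simplexP g S : simplex S ->
  S \in Sigma a g <-> forall j, j \notin S -> 0 < dotp g (gap S j).
Proof.
move=> sS; split.
  move=> /SigmaP[l [dom ST _]] j jS; rewrite gapE subr_gt0.
  rewrite -(interp_unique (l := l)) //; last by move=> i; rewrite ST inE => /eqP.
  by rewrite lt_def dom andbT eq_sym; move: jS; rewrite ST inE.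
move=> gS; apply/SigmaP; exists (interp S g); split; last exact: sS.1.
  move=> i; have [iS|iS] := boolP (i \in S); first by rewrite ev_interp.
  by have := gS i iS; rewrite gapE subr_gt0 => /ltW.
apply/setP => i; rewrite inE; have [iS|iS] := boolP (i \in S).
  by rewrite ev_interp // eqxx.
by have := gS i iS; rewrite gapE subr_gt0 => /lt_eqF->.
Qed.

Lemma ratio_test l d g k : dominates l g -> ev d k < 0 ->
  exists j t, [/\ ev d j < 0, dominates (l + t *: d) g
    & g 0 j = ev (l + t *: d) j].
Proof.
move=> dom dk; pose q i := (ev l i - g 0 i) / - ev d i.
case: (arg_minP (P := fun i => ev d i < 0) q dk) => j dj jmin.
have qE i : ev d i < 0 -> ev l i + q i * ev d i = g 0 i.
  by move=> di; rewrite /q; field; rewrite lt_eqF.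
exists j, (q j); split=> // [i|]; rewrite evD evZ; last by rewrite qE.
have [di|di] := ltP (ev d i) 0.
  by rewrite -qE // lerD2l ler_nM2r // jmin.
apply: le_trans (dom i) _; rewrite lerDl mulr_ge0 //.
by rewrite divr_ge0 ?subr_ge0 ?dom // oppr_ge0 ltW.
Qed.

Lemma Sigma_nonempty g : affinely_spanning a -> exists S, S \in Sigma a g.
Proof.
move=> span.
suff gen k l : dominates l g -> (n.+1 - affrank a (tight g l) <= k)%N ->
    exists S, S \in Sigma a g.
  apply: (gen _ (col_mx (\sum_i `|g 0 i|)%:M 0)) (leqnn _) => i.
  rewrite ev_col_mx mulmx0 !mxE eqxx mulr1n addr0 (bigD1 i) //=.
  by apply: ler_wpDr; [apply: sumr_ge0|apply: ler_norm].
elim: k l => [|k IH] l dom lk.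
  exists (tight g l); apply/SigmaP; exists l; split=> //.
  by apply/eqP; rewrite eqn_leq affrank_le -subn_eq0 -leqn0.
have [full|] := leqP n.+1 (affrank a (tight g l)).
  exists (tight g l); apply/SigmaP; exists l; split=> //.
  by apply/eqP; rewrite eqn_leq affrank_le.
move=> rl; have [d [dl [k0 dk]]] : exists d,
    {in tight g l, forall i, ev d i = 0} /\ exists k, ev d k < 0.
  have [d d0 dl] := affrank_ker rl; have [i di] : exists i, ev d i != 0.
    apply: contrapT => nd; move/eqP: d0; apply.
    apply: (affrank_ev0 span) => i _; apply/eqP; apply: contrapT => /negP di.
    by apply: nd; exists i.
  case: (ltgtP (ev d i) 0) di => // di _; first by exists d; split=> //; exists i.
  exists (- d); split; last by exists i; rewrite evN oppr_lt0.
  by move=> j jl; rewrite evN dl // oppr0.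
have [j [t [dj dom2 gj]]] := ratio_test dom dk.
apply: (IH _ dom2).
have sub : tight g l \subset tight g (l + t *: d).
  apply/fintype.subsetP => i il; have := il; rewrite !inE => /eqP->.
  by rewrite evD evZ dl // mulr0 addr0.
suff lt : (affrank a (tight g l) < affrank a (tight g (l + t *: d)))%N.
  by rewrite leq_subLR (leq_trans _ (leq_add lt (leqnn k))) // addSnnS -leq_subLR.
have sp := affrank_sub sub.
rewrite ltn_neqAle (mxrankS sp) andbT (mxrank_leqif_sup sp).
apply/negP => /submxP[D PE]; have : ev d j = 0.
  have /points_ev0 h : points (tight g (l + t *: d)) *m d = 0.
    by rewrite PE -mulmxA; have /points_ev0 -> := dl; rewrite mulmx0.
  by apply: h; rewrite inE gj.
by move=> dj0; rewrite dj0 ltxx in dj.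
Qed.

Lemma simplex_facet S i : simplex S -> i \in S -> (0 < n)%N ->
  facet_of a S (S :\ i).
Proof.
move=> sS iS n0; have [rS cS] := sS.
have cF : #|S :\ i| = n by apply/eqP; rewrite -eqSS -cS (cardsD1 i S) iS.
split; last first.
  apply/eqP; rewrite eqn_leq; apply/andP; split.
    by rewrite -{2}cF affrank_card.
  rewrite -ltnS -rS -{1}(finset.setD1K iS) -add1n.
  by apply: leq_trans (affrankU _ _) _; rewrite leq_add ?affrank1.
have [j0 j0F] : exists j, j \in S :\ i by apply/card_gt0P; rewrite cF.
pose d := col i (dual S); exists (- (dsubmx d)^T).
have vE k : (- (dsubmx d)^T *m (a k)^T) 0 0 = usubmx d 0 0 - ev d k.
  rewrite -[in ev d k](vsubmxK d) ev_col_mx -[- _ *m _]mx11_tr.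
  rewrite trmx_mul raddfN /= !trmxK mulmxN mxE; ring.
have dE k : k \in S -> ev d k = (i == k)%:R by move=> kS; apply: dualE.
apply/setP => k; rewrite !inE andbC.
have [kS|//] := boolP (k \in S); rewrite /=; apply/idP/forallP => [ki j|kP].
  by apply/implyP => jS; rewrite !vE !dE // [i == k]eq_sym (negbTE ki) lerB //.
move: (kP j0); move: j0F; rewrite !inE => /andP[j0i j0S].
rewrite j0S !vE !dE // [i == j0]eq_sym (negbTE j0i) [k == i]eq_sym.
by case: (i == k) => //=; lra.
Qed.

Lemma dual_expand S l : simplex S -> l = \sum_(i in S) ev l i *: col i (dual S).
Proof.
move=> sS; rewrite {1}(@interp_unique S (\row_i ev l i) l) //; last first.
  by move=> j _; rewrite mxE.
by apply: eq_bigr => i _; rewrite mxE.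
Qed.

End AffineFunctions.

(** * Secondary cone and dual graph *)

Section Triangulation.
Variables (R : realType) (m n : nat) (a : 'I_m -> 'rV[R]_n) (h : 'rV[R]_m).
Hypotheses (a_span : affinely_spanning a) (h_tri : triangulation a h).
Implicit Types (g x : 'rV[R]_m) (S : {set 'I_m}).

Local Notation ev := (ev a).
Local Notation gap := (gap a).
Local Notation interp := (interp a).
Local Notation dual := (dual a).

Lemma Sigma_simplex S : S \in Sigma a h -> simplex a S.
Proof. by move=> Sh; split; [have /SigmaP[l []] := Sh|apply: h_tri]. Qed.

(* One step of the simplex method for the linear programs
   min { sum of l over given points | l affine, l >= h }. *)
Lemma pivot S i k : S \in Sigma a h -> i \in S -> ev (col i (dual S)) k < 0 ->
  exists j, [/\ j \notin S, ev (col i (dual S)) j < 0,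
    j |: S :\ i \in Sigma a h & [set S; j |: S :\ i]%SET \in Gamma a h].
Proof.
move=> Sh iS dk; have sS := Sigma_simplex Sh; have [rS cS] := sS.
set d := col i (dual S); have dE k' : k' \in S -> ev d k' = (i == k')%:R.
  by move=> k'S; apply: dualE.
have dom : dominates a (interp S h) h.
  move=> j; have [jS|jS] := boolP (j \in S); first by rewrite ev_interp.
  by have /(Sigma_simplexP _ sS)/(_ j jS) := Sh; rewrite gapE subr_gt0 => /ltW.
have [j [t [dj dom2 hj]]] := ratio_test dom dk.
have jS : j \notin S.
  by apply/negP => jS; move: dj; rewrite dE // ltrn0.
set S2 := j |: S :\ i.
have S2sub : S2 \subset tight a h (interp S h + t *: d).
  apply/fintype.subsetP => k'; rewrite !inE => /orP[/eqP->|/andP[k'i k'S]].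
    by rewrite -hj.
  by rewrite evD evZ ev_interp // dE // [i == _]eq_sym (negbTE k'i) mulr0 addr0.
have rT : affrank a (tight a h (interp S h + t *: d)) = n.+1.
  apply/eqP; rewrite eqn_leq affrank_le leqNgt; apply/negP => /affrank_ker[l l0 lT].
  have lS2 k' : k' \in S2 -> ev l k' = 0 by move=> /(fintype.subsetP S2sub) /lT.
  have lE : l = ev l i *: d.
    rewrite {1}(dual_expand l sS) (bigD1 i) //= big1 ?addr0 // => k' /andP[k'S k'i].
    by rewrite lS2 ?scale0r // !inE k'i k'S orbT.
  have li : ev l i = 0.
    have : ev l j = 0 by apply: lS2; rewrite !inE eqxx.
    rewrite {1}lE evZ => /eqP; rewrite mulf_eq0 (lt_eqF dj) orbF.
    by move/eqP.
  by move/eqP: l0; apply; rewrite lE li scale0r.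
have Th : tight a h (interp S h + t *: d) \in Sigma a h.
  by apply/SigmaP; exists (interp S h + t *: d).
have jSi : j \notin S :\ i by rewrite !inE negb_and jS orbT.
have cF : #|S :\ i| = n by apply/eqP; rewrite -eqSS -cS (cardsD1 i S) iS.
have S2E : S2 = tight a h (interp S h + t *: d).
  apply/eqP; rewrite eqEcard S2sub h_tri // /S2 cardsU1 jSi cF.
  by rewrite add1n leqnn.
have S2h : S2 \in Sigma a h by rewrite S2E.
have n0 : (0 < n)%N.
  rewrite lt0n; apply/eqP => n0; move: dj.
  have -> : ev d j = ev d i.
    apply: eq_ev.
    by apply/rowP => -[k' k'n]; exfalso; move: k'n; rewrite n0.
  by rewrite dE // eqxx ltr10.
have sS2 := Sigma_simplex S2h.
exists j; split=> //; rewrite inE; apply/asboolP; exists S, S2; split=> //.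
  by apply/eqP => SS2; move: jS; rewrite SS2 !inE eqxx.
exists (S :\ i); split; first exact: simplex_facet.
have <- : S2 :\ j = S :\ i by rewrite /S2 finset.setU1K.
by apply: simplex_facet => //; rewrite !inE eqxx.
Qed.

Lemma descent_step g S S' : {subset Sigma a h <= Sigma a g} ->
  S \in Sigma a h -> S' \in Sigma a g -> S != S' ->
  exists S2, [/\ S2 \in Sigma a h, [set S; S2]%SET \in Gamma a h
    & \sum_(k in S') ev (interp S2 g) k < \sum_(k in S') ev (interp S g) k].
Proof.
move=> hg Sh S'g SS'; have sS := Sigma_simplex Sh; have [rS cS] := sS.
have gS := (Sigma_simplexP g sS).1 (hg _ Sh).
have /SigmaP[l [dom S'T rS']] := S'g.
have lS' k : k \in S' -> ev l k = g 0 k by rewrite S'T inE => /eqP.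
have [k0 k0S' k0S] : exists2 k, k \in S' & k \notin S.
  apply/subsetPn; apply: contra SS' => S'S; rewrite eq_sym eqEcard S'S /=.
  by rewrite cS -rS' affrank_card.
have cost_lt : \sum_(k in S') (g 0 k - ev (interp S g) k) < 0.
  rewrite (bigD1 k0) //=; apply: ltr_wnDr.
    apply: sumr_le0 => k _; rewrite subr_le0.
    have [kS|kS] := boolP (k \in S); first by rewrite ev_interp.
    by have := gS k kS; rewrite gapE subr_gt0 => /ltW.
  by have := gS k0 k0S; rewrite gapE subr_gt0 subr_lt0.
pose c i := \sum_(k in S') ev (col i (dual S)) k.
have costE : \sum_(k in S') (g 0 k - ev (interp S g) k) =
    \sum_(i in S) (ev l i - g 0 i) * c i.
  have lE : l - interp S g = \sum_(i in S) (ev l i - g 0 i) *: col i (dual S).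
    rewrite [LHS](dual_expand _ sS); apply: eq_bigr => i iS.
    by rewrite evD evN ev_interp.
  under eq_bigr => k kS' do rewrite -lS' // -evN -evD lE ev_sum.
  rewrite exchange_big /=; apply: eq_bigr => i iS; rewrite mulr_sumr.
  by apply: eq_bigr => k kS'; rewrite evZ.
have [i iS ci] : exists2 i, i \in S & c i < 0.
  apply: contrapT => nc; move: cost_lt; rewrite costE ltNge sumr_ge0 // => i iS.
  rewrite mulr_ge0 ?subr_ge0 ?dom // leNgt; apply/negP => ci.
  by apply: nc; exists i.
have [k dk] : exists k, ev (col i (dual S)) k < 0.
  apply: contrapT => nd; move: ci; rewrite ltNge sumr_ge0 // => k _.
  by rewrite leNgt; apply/negP => dk; apply: nd; exists k.
have [j [jS dj S2h S2G]] := pivot Sh iS dk.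
exists (j |: S :\ i); split=> //.
set d := col i (dual S) in dk dj *.
pose t := (ev (interp S g) j - g 0 j) / - ev d j.
have t0 : 0 < t.
  by rewrite divr_gt0 ?oppr_gt0 //; have := gS j jS; rewrite gapE.
rewrite -(@interp_unique _ _ _ a (j |: S :\ i) g (interp S g + t *: d)).
- under eq_bigr do rewrite evD evZ.
  by rewrite big_split /= -mulr_sumr gtrDl pmulr_rlt0.
- exact: Sigma_simplex.
move=> k'; rewrite !inE evD evZ => /orP[/eqP->|/andP[k'i k'S]].
  by rewrite /t; field; rewrite lt_eqF.
by rewrite ev_interp // dualE // [i == _]eq_sym (negbTE k'i) mulr0 addr0.
Qed.

Lemma descent g S S' : {subset Sigma a h <= Sigma a g} ->
  S \in Sigma a h -> S' \in Sigma a g ->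
  S' \in Sigma a h /\ connect (edge_rel (enum (Gamma a h))) S S'.
Proof.
move=> hg + S'g; pose cost S := \sum_(k in S') ev (interp S g) k.
pose lower S := [set S2 in Sigma a h | cost S2 < cost S]%SET.
move: {2}#|lower S|.+1 (ltnSn #|lower S|) => N; elim: N S => [//|N IH] S SN Sh.
have [SE|SS'] := eqVneq S S'; first by rewrite -SE connect0.
have [S2 [S2h e2 lt2]] := descent_step hg Sh S'g SS'.
have [|S'h c2] := IH S2 _ S2h.
  rewrite ltnS in SN; apply: leq_trans SN; apply: proper_card.
  apply/properP; split.
    apply/fintype.subsetP => S3; rewrite !inE => /andP[-> /= lt3].
    exact: lt_trans lt3 lt2.
  by exists S2; rewrite inE S2h /= ?ltxx.
split=> //; apply: connect_trans c2; apply: connect1.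
by rewrite /edge_rel mem_enum.
Qed.

Lemma Gamma_connected :
  {in Sigma a h &, forall S S', connect (edge_rel (enum (Gamma a h))) S S'}.
Proof. by move=> S S' Sh S'h; have [] := @descent h S S' (fun _ => id) Sh S'h. Qed.

Lemma Sigma_eqP g : Sigma a g = Sigma a h <->
  {in Sigma a h, forall S j, j \notin S -> 0 < dotp g (gap S j)}.
Proof.
split=> [gh S Sh|gap0].
  by apply/Sigma_simplexP; [apply: Sigma_simplex|rewrite gh].
have hg : {subset Sigma a h <= Sigma a g}.
  by move=> S Sh; apply/Sigma_simplexP; [apply: Sigma_simplex|apply: gap0].
have [S Sh] := Sigma_nonempty h a_span.
apply/setP => S'; apply/idP/idP => [S'g|/hg//].
by have [] := descent hg Sh S'g.
Qed.

Lemma secondary_coneP g : secondary_cone a h g <->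
  {in Sigma a h, forall S j, 0 <= dotp g (gap S j)}.
Proof.
have h0 S j : S \in Sigma a h -> j \notin S -> 0 < dotp h (gap S j).
  by move=> Sh; apply: (Sigma_eqP h).1.
split=> [scg S Sh j|gap0].
  apply: closure_halfspace scg => x /= /Sigma_eqP/(_ S Sh j) x0.
  have [jS|jS] := boolP (j \in S); last exact/ltW/x0.
  by rewrite gap_in //; apply: Sigma_simplex.
apply: (closure_right (y := h)).
apply: filterS (nbhs_right_gt (0 : R)) => t t0; apply/Sigma_eqP => S Sh j jS.
by rewrite dotp_ray ltr_wpDl ?gap0 // mulr_gt0 // h0.
Qed.

Lemma secondary_cone_ray g t : secondary_cone a h g -> 0 < t ->
  Sigma a (g + t *: h) = Sigma a h.
Proof.
move=> /secondary_coneP g0 t0; apply/Sigma_eqP => S Sh j jS.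
by rewrite dotp_ray ltr_wpDl ?g0 // mulr_gt0 //; apply: (Sigma_eqP h).1.
Qed.

Lemma Gamma_cover r : r \in Gamma a h -> exists S j,
  [/\ S \in Sigma a h, j \notin S, finset.cover r = j |: S
    & #|finset.cover r| = (1 + (n + 1))%N].
Proof.
rewrite inE => /asboolP[S [S' [Sh S'h SS' rE [F [FS FS']]]]].
have [[rS cS] [rS' cS']] := (Sigma_simplex Sh, Sigma_simplex S'h).
have FsubS S0 : facet_of a S0 F -> F \subset S0.
  by move=> [[c ->] _]; apply/fintype.subsetP => i; rewrite inE => /andP[].
have cF : (n <= #|F|)%N by case: FS => _ <-; apply: affrank_card.
have nI : (n <= #|S :&: S'|)%N.
  by apply: leq_trans cF _; apply: subset_leq_card; rewrite finset.subsetI !FsubS.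
have [j jS' jS] : exists2 j, j \in S' & j \notin S.
  apply/subsetPn; apply: contra SS' => S'S; rewrite eq_sym eqEcard S'S /=.
  by rewrite cS cS'.
have cov : finset.cover r = S :|: S'.
  by rewrite rE /finset.cover finset.bigcup_setU !big_set1.
have cU : #|S :|: S'| = (1 + (n + 1))%N.
  apply/eqP; rewrite eqn_leq; apply/andP; split.
    by rewrite cardsU cS cS' leq_subLR; move: nI; lia.
  apply: leq_trans (subset_leq_card (_ : j |: S \subset _)).
    by rewrite cardsU1 jS cS addn1 add1n.
  by rewrite finset.subUset finset.sub1set !inE jS' orbT finset.subsetUl.
exists S, j; rewrite cov; split=> //; apply/esym/eqP; rewrite eqEcard.
rewrite finset.subUset finset.sub1set !inE jS' orbT finset.subsetUl /=.
by rewrite cU cardsU1 jS cS addn1 add1n.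
Qed.

Lemma Gamma_graph : graph_on (Sigma a h) (Gamma a h).
Proof.
move=> r; rewrite inE => /asboolP[S [S' [Sh S'h SS' -> _]]]; split.
  by rewrite finset.subUset !finset.sub1set Sh.
by rewrite cards2 SS'.
Qed.

End Triangulation.

(** * Edge lengths *)

Section Determinants.
Variables (R : realType) (m n : nat) (a : 'I_m -> 'rV[R]_n).
Implicit Types (g x : 'rV[R]_m) (S : {set 'I_m}) (s t : (1 + (n + 1)).-tuple 'I_m).

Local Notation ev := (ev a).

Definition height_col : 'I_(1 + (n + 1)) := rshift 1 (rshift n ord0).

Lemma hom_lift_height g k : hom (lift_pt a g k) 0 height_col = g 0 k.
Proof. by rewrite /hom /lift_pt !row_mxEr mxE eqxx mulr1n. Qed.

Lemma hom_lift_base g x k j : j != height_col ->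
  hom (lift_pt a g k) 0 j = hom (lift_pt a x k) 0 j.
Proof.
case: (split_ordP j) => [j1|j2] ->; first by rewrite /hom !row_mxEl.
case: (split_ordP j2) => [j3|j3] ->; first by rewrite /hom /lift_pt !row_mxEr !row_mxEl.
by rewrite (ord1 j3) eqxx.
Qed.

Definition det_coef (s : seq 'I_m) : 'cV[R]_m :=
  \col_k \det (height_mx a (delta_mx 0 k) s).

Lemma height_mx_cofactor g x (s : seq 'I_m) i :
  cofactor (height_mx a g s) i height_col = cofactor (height_mx a x s) i height_col.
Proof.
rewrite /cofactor; congr (_ * \det _); apply/matrixP => p q; rewrite !mxE.
have : lift height_col q != height_col by rewrite eq_sym neq_lift.
move: (lift _ q) => j jn; elim: s (nat_of_ord _) => [|k s IH] [|N] //=.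
  exact: hom_lift_base.
Qed.

Lemma det_height g (s : seq 'I_m) : \det (height_mx a g s) = dotp g (det_coef s).
Proof.
have lin i : height_mx a g s i height_col =
    \sum_k g 0 k * height_mx a (delta_mx 0 k) s i height_col.
  under eq_bigr do rewrite mxE.
  rewrite mxE; elim: s (nat_of_ord i) => [|k s IH] [|N] //=.
  - by rewrite mxE big1 // => k _; rewrite mulr0.
  - by rewrite mxE big1 // => k _; rewrite mulr0.
  rewrite hom_lift_height (bigD1 k) //= hom_lift_height mxE !eqxx mulr1 big1 ?addr0 //.
  by move=> j jk; rewrite hom_lift_height mxE [k == j]eq_sym (negbTE jk) andbF mulr0.
rewrite (expand_det_col _ height_col) mxE.
under [RHS]eq_bigr do rewrite mxE (expand_det_col _ height_col) mulr_sumr.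
rewrite exchange_big /=; apply: eq_bigr => i _; rewrite lin mulr_suml.
apply: eq_bigr => k _; rewrite -mulrA; congr (_ * (_ * _));
  exact: (height_mx_cofactor g (delta_mx 0 k) s i).
Qed.

Lemma row_height_mx g s i :
  row i (height_mx a g s) = hom (lift_pt a g (tnth s i)).
Proof. by rewrite rowK (nth_map (tnth s i)) ?size_tuple // -tnth_nth. Qed.

Lemma hom_lift_mul g k (c : 'M[R]_1) v (w : 'M[R]_1) :
  (hom (lift_pt a g k) *m col_mx c (col_mx v w)) 0 0 =
  ev (col_mx c v) k + g 0 k * w 0 0.
Proof.
rewrite ev_col_mx /hom /lift_pt !mul_row_col mxE -addrA; congr (_ + _).
  by rewrite mxE big_ord1 mxE mul1r.
by rewrite mxE mul_scalar_mx; congr (_ + _); rewrite mxE.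
Qed.

Lemma det_height_eq0 g S j s : simplex a S -> s =i j |: S ->
  \det (height_mx a g s) = 0 <-> dotp g (gap a S j) = 0.
Proof.
move=> sS sE; split.
  move=> d0; have /eqP := d0; rewrite -det_tr => /det0P[u u0 uA].
  have Au : height_mx a g s *m u^T = 0 by rewrite -[LHS]trmxK trmx_mul trmxK uA trmx0.
  move: u0; rewrite -(inj_eq (@trmx_inj _ _ _)) trmx0; move: {uA} (u^T) Au => {}u Au u0.
  set c := usubmx u; set v := usubmx (dsubmx u); set w := dsubmx (dsubmx u).
  have uE : u = col_mx c (col_mx v w) by rewrite !vsubmxK.
  have Ak k : k \in j |: S -> ev (col_mx c v) k + g 0 k * w 0 0 = 0.
    rewrite -sE => /tnthP[i ->]; rewrite -hom_lift_mul -uE -row_height_mx -row_mul Au.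
    by rewrite row0 mxE.
  have w0 : w 0 0 != 0.
    apply: contraNneq u0 => w0; have cv0 : col_mx c v = 0.
      apply: (affrank_ev0 sS.1) => k kS.
      by have := Ak k; rewrite w0 mulr0 addr0; apply; rewrite !inE kS orbT.
    have w00 : w = 0 by apply/matrixP => p q; rewrite !ord1 w0 mxE.
    move/eqP: cv0; rewrite col_mx_eq0 uE w00 => /andP[/eqP-> /eqP->].
    by rewrite !col_mx0.
  have lE : (- (w 0 0)^-1) *: col_mx c v = interp a S g.
    apply: interp_unique => // k kS; rewrite evZ.
    have /eqP := Ak k ltac:(by rewrite !inE kS orbT); rewrite addr_eq0 => /eqP->.
    by rewrite mulrNN mulrC mulfK.
  rewrite gapE -lE evZ; have /eqP := Ak j ltac:(by rewrite !inE eqxx).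
  by rewrite addr_eq0 => /eqP->; rewrite mulrNN mulrC mulfK // subrr.
move=> gap0; apply/eqP; apply: contraT => d0.
have uA : height_mx a g s \in unitmx by rewrite unitmxE unitfE.
set l := interp a S g; pose u := col_mx (usubmx l) (col_mx (dsubmx l) (- 1%:M)).
have : u = 0 :> 'cV[R]_(1 + (n + 1)).
  apply: (can_inj (mulKmx uA)); rewrite mulmx0; apply/row_matrixP => i.
  rewrite row_mul row_height_mx row0; apply/matrixP => p q; rewrite !ord1 [RHS]mxE.
  rewrite hom_lift_mul vsubmxK !mxE eqxx mulr1n mulrN1.
  have : tnth s i \in j |: S by rewrite -sE mem_tnth.
  rewrite !inE => /orP[/eqP->|kS]; first by rewrite -gapE gap0.
  by rewrite ev_interp // subrr.
move=> /eqP; rewrite !col_mx_eq0 oppr_eq0 => /and3P[_ _ /eqP/matrixP/(_ 0 0)].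
by rewrite !mxE eqxx => /eqP; rewrite oner_eq0.
Qed.

Lemma height_col_neq0 : lshift (n + 1) ord0 != height_col :> 'I_(1 + (n + 1)).
Proof. by rewrite eq_lrshift. Qed.

Lemma det_height_swap s : exists t,
  forall g, \det (height_mx a g t) = - \det (height_mx a g s).
Proof.
pose p := tperm (lshift (n + 1) ord0) height_col.
exists [tuple tnth s (p i) | i < 1 + (n + 1)] => g.
have -> : height_mx a g [tuple tnth s (p i) | i < 1 + (n + 1)] =
    row_perm p (height_mx a g s).
  apply/row_matrixP => i; rewrite row_height_mx tnth_mktuple -row_height_mx.
  by apply/rowP => j; rewrite !mxE.
by rewrite row_permE det_mulmx det_perm odd_tperm height_col_neq0 expr1 mulN1r.
Qed.

Lemma generic_tie g s t : generic a g ->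
  \det (height_mx a g s) = \det (height_mx a g t) ->
  forall x, \det (height_mx a x s) = \det (height_mx a x t).
Proof.
move=> gg gst x; have tieT : tie_space a s t = [set: 'rV[R]_m]%classic.
  by apply: contrapT => /gg; apply.
by have : tie_space a s t x by rewrite tieT.
Qed.

Lemma generic_tieN g s t : generic a g ->
  \det (height_mx a g s) = - \det (height_mx a g t) ->
  forall x, \det (height_mx a x s) = - \det (height_mx a x t).
Proof.
move=> gg; have [t' t'E] := det_height_swap t; rewrite -t'E => gst x.
by rewrite -t'E; apply: (generic_tie gg gst).
Qed.

Lemma generic_ray x g : generic a g ->
  (\forall u \near 0^'+, generic a (x + u *: g))%classic.
Proof.
move=> gg; apply: filter_forall => s; apply: filter_forall => t.
have [tT|nT] := pselect (tie_space a s t = [set: 'rV[R]_m]%classic).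
  by near=> u => /(_ tT).
have gst : dotp g (det_coef s - det_coef t) != 0.
  rewrite mulmxBr mxE [X in _ + X]mxE -!det_height subr_eq0; apply/eqP; exact: gg.
have := near_right_neq0 (or_intror gst).
move=> /(_ (dotp x (det_coef s - det_coef t))); apply: filterS => u.
rewrite -dotp_ray mulmxBr mxE [X in _ + X]mxE -!det_height subr_eq0 => /eqP nst _.
exact: nst.
Unshelve. all: by end_near. Qed.

End Determinants.

Section EdgeLengths.
Variables (R : realType) (m n : nat) (a : 'I_m -> 'rV[R]_n) (h : 'rV[R]_m).
Hypotheses (a_span : affinely_spanning a) (h_tri : triangulation a h).
Implicit Types (g x : 'rV[R]_m) (S : {set 'I_m}) (r : {set {set 'I_m}}).

Definition edge_det g r : R := \det (height_mx a g (enum (finset.cover r))).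

(* On the secondary cone of h, the determinant has the sign that it has at h. *)
Definition edge_coef r : 'cV[R]_m :=
  Num.sg (edge_det h r) *: det_coef a (enum (finset.cover r)).

Lemma edge_coefE g r : dotp g (edge_coef r) = Num.sg (edge_det h r) * edge_det g r.
Proof. by rewrite /edge_coef -scalemxAr mxE -det_height. Qed.

Lemma edge_tuple r : r \in Gamma a h -> exists s : (1 + (n + 1)).-tuple 'I_m,
  s = enum (finset.cover r) :> seq 'I_m.
Proof.
move=> /(Gamma_cover h_tri)[_ [_ [_ _ _ /eqP cr]]].
by rewrite cardE in cr; exists (Tuple cr).
Qed.

Lemma edge_det_neq0 g r : Sigma a g = Sigma a h -> r \in Gamma a h ->
  edge_det g r != 0.
Proof.
move=> /(Sigma_eqP a_span h_tri) gh rG; have [s sE] := edge_tuple rG.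
have [S [j [Sh jS cr _]]] := Gamma_cover h_tri rG.
have sS := Sigma_simplex h_tri Sh.
have sm : s =i j |: S by move=> k; rewrite -cr -[RHS]mem_enum -sE.
rewrite /edge_det -sE; apply/eqP => /(det_height_eq0 g sS sm) g0.
by have := gh S Sh j jS; rewrite g0 ltxx.
Qed.

(* A sign change between g and h would make the determinant vanish at some
   g + t h, which induces the same subdivision as h. *)
Lemma edge_coef_ge0 g r : secondary_cone a h g -> r \in Gamma a h ->
  0 <= dotp g (edge_coef r).
Proof.
move=> scg rG; rewrite leNgt; apply/negP => g0.
have h0 : 0 < dotp h (edge_coef r).
  by rewrite edge_coefE -normrEsg normr_gt0 edge_det_neq0.
pose t := - dotp g (edge_coef r) / dotp h (edge_coef r).
have t0 : 0 < t by rewrite divr_gt0 ?oppr_gt0.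
have : dotp (g + t *: h) (edge_coef r) = 0.
  by rewrite dotp_ray /t divfK ?gt_eqF // subrr.
rewrite edge_coefE => /eqP; rewrite mulf_eq0 sgr_eq0.
rewrite (negbTE (edge_det_neq0 _ rG)) //.
by rewrite (negbTE (edge_det_neq0 (secondary_cone_ray a_span h_tri scg t0) rG)).
Qed.

Lemma edge_length_coef g r : secondary_cone a h g -> r \in Gamma a h ->
  edge_length a g r = dotp g (edge_coef r).
Proof.
move=> scg rG; rewrite -[RHS]ger0_norm ?edge_coef_ge0 // edge_coefE normrM.
by rewrite normr_sg edge_det_neq0 // mul1r.
Qed.

Lemma generic_edge_tie g r s : generic a g -> r \in Gamma a h -> s \in Gamma a h ->
  dotp g (edge_coef r) = dotp g (edge_coef s) ->
  forall x, dotp x (edge_coef r) = dotp x (edge_coef s).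
Proof.
move=> gg rG sG; have [tr trE] := edge_tuple rG; have [ts tsE] := edge_tuple sG.
have e1 (u : {set {set 'I_m}}) : u \in Gamma a h ->
    Num.sg (edge_det h u) = 1 \/ Num.sg (edge_det h u) = -1.
  move=> uG; have := edge_det_neq0 (erefl _) uG.
  case: (ltgtP (edge_det h u) 0) => // u0 _; [right|left].
  - exact: ltr0_sg.
  exact: gtr0_sg.
move=> + x; rewrite !edge_coefE.
have [-> | ->] := e1 r rG; have [-> | ->] := e1 s sG;
  rewrite /edge_det -trE -tsE ?mul1r ?mulN1r => E.
- exact: (generic_tie gg E).
- exact: (generic_tieN gg E).
- by rewrite (generic_tieN gg (t := ts)) ?opprK //; apply: oppr_inj; rewrite opprK.
by congr (- _); apply: (generic_tie gg); apply: oppr_inj.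
Qed.

Lemma generic_interior g : generic a g -> secondary_cone a h g ->
  Sigma a g = Sigma a h.
Proof.
move=> gg scg; apply/(Sigma_eqP a_span h_tri) => S Sh j jS.
have sS := Sigma_simplex h_tri Sh; have [_ cS] := sS.
have /eqP cs : #|j |: S| = (1 + (n + 1))%N by rewrite cardsU1 jS cS addn1 add1n.
rewrite cardE in cs; pose s := Tuple cs.
have sm : s =i j |: S by move=> k; rewrite -[RHS]mem_enum.
rewrite lt_def ((secondary_coneP a_span h_tri g).1 scg) // andbT.
apply/eqP => /(det_height_eq0 g sS sm) g0.
have /(_ h) : forall x, \det (height_mx a x s) = - \det (height_mx a x s).
  by apply: (generic_tieN gg); rewrite g0 oppr0.
move/eqP; rewrite -addr_eq0 -mulr2n mulrn_eq0 /= => /eqP.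
move=> /(det_height_eq0 h sS sm) h0.
have := (Sigma_eqP a_span h_tri h).1 (erefl _) S Sh j jS.
by rewrite h0 ltxx.
Qed.

End EdgeLengths.

(** * The MST-fan *)

Local Open Scope classical_set_scope.

Section MSTCones.
Variables (R : realType) (m n : nat) (a : 'I_m -> 'rV[R]_n) (h : 'rV[R]_m).
Hypotheses (a_span : affinely_spanning a) (h_gen : generic a h)
  (h_tri : triangulation a h).
Implicit Types (f g x : 'rV[R]_m) (r s : {set {set 'I_m}}).
Implicit Types (T : seq {set {set 'I_m}}).

Local Notation ost := (ordered_spanning_tree a h).
Local Notation GammaG := (@Gamma_graph R m n a h).
Local Notation Gamma_conn := (Gamma_connected h_tri).
Local Notation secP := (secondary_coneP a_span h_tri).

Local Notation coef := (edge_coef a h).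

Definition coef_weight g r : R := dotp g (coef r).

Lemma secondary_cone_h : secondary_cone a h h.
Proof. exact: subset_closure. Qed.

Lemma Tmin_greedy g T : secondary_cone a h g ->
  Tmin a h g T <-> ost T /\ greedy_for (Gamma a h) (weight_le (coef_weight g)) T.
Proof.
move=> scg; have lenE := edge_length_coef a_span h_tri scg.
rewrite /Tmin (greedy_outputP GammaG _ _ Gamma_conn).
split=> -[oT gT]; split=> // i r iT rG rt nr; have := gT i r iT rG rt nr.
all: have [_ sT _ _] := oT; have iG : nth finset.set0 T i \in Gamma a h.
all: try by apply: sT; apply: mem_nth.
all: by rewrite /weight_le /coef_weight !lenE.
Qed.

Definition flag_coef T : 'cV[R]_m :=
  \sum_(k < (size T).+1) \sum_(e <- take k T) coef e.

Lemma flag_coefE g T : dotp g (flag_coef T) = flag_weight (coef_weight g) T.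
Proof.
rewrite mulmx_sumr summxE; apply: eq_bigr => k _.
by rewrite mulmx_sumr summxE.
Qed.

Definition tmin_cone T : set 'rV[R]_m :=
  [set g | secondary_cone a h g /\ Tmin a h g T].

Definition tmin_ineq T
    (c : {set 'I_m} * 'I_m + 'I_(size T) * {set {set 'I_m}}) : 'cV[R]_m :=
  match c with
  | inl (S0, j) => if S0 \in Sigma a h then gap a S0 j else 0
  | inr (i, r) =>
      if [&& r \in Gamma a h, r \notin take i T
           & `[< ~ has_cycle (rcons (take i T) r) >]]
      then coef r - coef (nth finset.set0 T i) else 0
  end.

Lemma tmin_coneE T : ost T -> tmin_cone T = halfspaces (@tmin_ineq T).
Proof.
move=> oT; apply/seteqP; split=> [g [scg]|g gT].
  move=> /(Tmin_greedy _ scg)[_ gT] [[S j]|[i r]] /=.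
    by case: ifP => Sh; [apply: (secP g).1|rewrite mulmx0 mxE].
  case: ifP => [/and3P[rG rt /asboolP nr]|_]; last by rewrite mulmx0 mxE.
  by rewrite mulmxBr mxE [X in _ + X]mxE subr_ge0; apply: gT.
have scg : secondary_cone a h g.
  by apply/secP => S Sh j; have := gT (inl (S, j)); rewrite /= Sh.
split=> //; apply/Tmin_greedy => //; split=> // i r iT rG rt nr.
have := gT (inr (Ordinal iT, r)); rewrite /= rG rt asboolT //=.
by rewrite mulmxBr mxE [X in _ + X]mxE subr_ge0.
Qed.

Lemma tmin_cone_polyhedral T : ost T -> polyhedral_cone (tmin_cone T).
Proof. by move=> /tmin_coneE->; apply: halfspaces_polyhedral. Qed.

Lemma tmin_cone_ray T x g t : ost T -> tmin_cone T x -> tmin_cone T g -> 0 < t ->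
  tmin_cone T (x + t *: g).
Proof.
move=> /tmin_coneE-> xT gT t0 c; rewrite dotp_ray.
by rewrite addr_ge0 ?mulr_ge0 ?(ltW t0).
Qed.

Lemma tmin_cone_flag_le T T' g : ost T' -> tmin_cone T g ->
  dotp g (flag_coef T) <= dotp g (flag_coef T').
Proof.
move=> oT' [scg /(Tmin_greedy _ scg)[oT gT]]; rewrite !flag_coefE.
exact: (flag_weight_le GammaG).
Qed.

Lemma tmin_cone_flag_eq T T' g : ost T' -> tmin_cone T g ->
  dotp g (flag_coef T') = dotp g (flag_coef T) -> tmin_cone T' g.
Proof.
move=> oT' [scg /(Tmin_greedy _ scg)[oT gT]]; rewrite !flag_coefE => E.
split=> //; apply/Tmin_greedy => //; split=> //.
exact: (flag_weight_eq GammaG oT gT oT').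
Qed.

Lemma tmin_cone_inter T T' : ost T -> ost T' ->
  cone_face (tmin_cone T) (tmin_cone T `&` tmin_cone T').
Proof.
move=> oT oT'; exists (flag_coef T' - flag_coef T).
have E g : dotp g (flag_coef T' - flag_coef T) =
    dotp g (flag_coef T') - dotp g (flag_coef T).
  by rewrite mulmxBr mxE [X in _ + X]mxE.
split=> [g gT|]; first by rewrite E subr_ge0 tmin_cone_flag_le.
apply/seteqP; split=> g /=.
  move=> [gT gT']; split=> //; rewrite E; apply/eqP; rewrite subr_eq0 eq_le.
  by rewrite !tmin_cone_flag_le.
move=> [gT /eqP]; rewrite E subr_eq0 => /eqP Eg; split=> //.
exact: tmin_cone_flag_eq Eg.
Qed.

Lemma mst_coneE T : realizable a h T -> mst_cone a h T = tmin_cone T.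
Proof.
move=> [oT [g [gg scg gT]]]; apply/seteqP; split=> x.
  move=> cx; rewrite tmin_coneE // => c; apply: closure_halfspace cx => y [_ scy yT].
  by have : tmin_cone T y by []; rewrite tmin_coneE //; apply.
move=> xT; apply: (closure_right (y := g)).
apply: filterS2 (nbhs_right_gt (0 : R)) (generic_ray x gg) => t t0 gt.
by have [] := @tmin_cone_ray T x g t oT xT (conj scg gT) t0.
Qed.

(* At a generic g an inequality of the cone is strict or trivial. *)
Lemma tmin_cone_absorbing T g : ost T -> mst_generic_cone a h T g ->
  absorbing (tmin_cone T) g.
Proof.
move=> oT [gg scg gT] v; rewrite tmin_coneE //; apply: filter_forall => c.
have [c0|c0] : 0 < dotp g (tmin_ineq c) \/ forall x, dotp x (tmin_ineq c) = 0.
- have /= zero x : dotp x (0 : 'cV_m) = 0 by rewrite mulmx0 mxE.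
  case: c => [[S j]|[i r]] /=.
    case: ifP => Sh; last by right.
    have [jS|jS] := boolP (j \in S).
      by right => x; apply: gap_in => //; apply: (Sigma_simplex h_tri).
    left; apply: (Sigma_eqP a_span h_tri g).1 => //.
    exact: (generic_interior a_span h_tri gg).
  case: ifP => [/and3P[rG rt /asboolP nr]|_]; last by right.
  have [_ sT _ _] := oT.
  have iG : nth finset.set0 T i \in Gamma a h by apply: sT; apply: mem_nth.
  have E x : dotp x (coef r - coef (nth finset.set0 T i)) =
      dotp x (coef r) - dotp x (coef (nth finset.set0 T i)).
    by rewrite mulmxBr mxE [X in _ + X]mxE.
  have /(Tmin_greedy _ scg)[_ gr] := gT.
  have := gr i r (ltn_ord i) rG rt nr; rewrite /weight_le le_eqVlt.
  move=> /orP[/eqP tie|lt]; [right => x|by left; rewrite E subr_gt0].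
  by rewrite E (generic_edge_tie a_span h_tri gg iG rG tie) subrr.
- apply: filterS (near_right_gt0 (dotp v (tmin_ineq c)) c0) => t /ltW.
  by rewrite dotp_ray.
by near=> t; rewrite c0.
Unshelve. all: by end_near. Qed.

(* Breaking the ties of x by the lengths at h gives a processing order that is
   also valid at x + t h for all small t > 0. *)
Lemma exists_realizable x : secondary_cone a h x ->
  exists T, realizable a h T /\ Tmin a h x T.
Proof.
move=> scx; pose wx := edge_length a x; pose wh := edge_length a h.
pose le r s := (wx r < wx s) || ((wx r == wx s) && (wh r <= wh s)).
have le_tot : total le.
  by move=> r s; rewrite /le; case: ltgtP => //= _; apply: le_total.
have le_tr : transitive le.
  move=> s r t /orP[rs|/andP[/eqP rs irs]] /orP[st|/andP[/eqP st ist]]; apply/orP.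
  - by left; apply: lt_trans rs st.
  - by left; rewrite -st.
  - by left; rewrite rs.
  by right; rewrite rs st eqxx (le_trans irs).
pose es := sort le (enum (Gamma a h)).
have pes : perm_eq es (enum (Gamma a h)) by rewrite perm_sort.
have esE : es =i Gamma a h by move=> r; rewrite (perm_mem pes) mem_enum.
have Ues : uniq es by rewrite (perm_uniq pes) enum_uniq.
have ses : sorted le es by apply: sort_sorted.
exists (kruskal es); split; last first.
  exists es; split=> //; apply: sub_sorted ses => r s.
  move=> rs; suff : wx r <= wx s by [].
  by case/orP: rs => [/ltW//|/andP[/eqP-> _]]; apply: lexx.
split; first exact: (kruskal_spanning_tree Gamma_conn esE Ues).
have near_le : \forall t \near 0^'+, forall r s, r \in Gamma a h ->
    s \in Gamma a h -> le r s ->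
    dotp (x + t *: h) (coef r) <= dotp (x + t *: h) (coef s).
  apply: filter_forall => r; apply: filter_forall => s.
  have [rG|nr] := boolP (r \in Gamma a h); last by near=> t.
  have [sG|ns] := boolP (s \in Gamma a h); last by near=> t.
  have [/orP[rs|/andP[/eqP rs hrs]]|nle] := boolP (le r s); last by near=> t.
    have rs0 : 0 < dotp x (coef s) - dotp x (coef r).
      by rewrite subr_gt0 -!(edge_length_coef a_span h_tri scx).
    have := near_right_gt0 (dotp h (coef s) - dotp h (coef r)) rs0.
    by apply: filterS => t + _ _ _; rewrite !dotp_ray; lra.
  apply: filterS (nbhs_right_gt (0 : R)) => t t0 _ _ _; rewrite !dotp_ray.
  rewrite -!(edge_length_coef a_span h_tri scx) // -/(wx r) rs lerD2l ler_pM2l //.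
  by rewrite -!(edge_length_coef a_span h_tri secondary_cone_h).
have [t [t0 [gt let_]]] := filter_ex (filterI (nbhs_right_gt (0 : R))
  (filterI (generic_ray x h_gen) near_le)).
have sct : secondary_cone a h (x + t *: h).
  by apply: subset_closure; apply: secondary_cone_ray.
exists (x + t *: h); split=> //; exists es; split=> //.
apply: (sub_in_sorted (P := mem (Gamma a h)) (e := le)) ses => [r s rG sG|].
  by rewrite !(edge_length_coef a_span h_tri sct) //; apply: let_.
by apply/allP => r; rewrite esE.
Unshelve. all: by end_near. Qed.

End MSTCones.

Section MSTFan.
Variables (R : realType) (m n : nat) (a : 'I_m -> 'rV[R]_n) (h : 'rV[R]_m).
Hypotheses (a_span : affinely_spanning a) (h_gen : generic a h)
  (h_tri : triangulation a h).
Implicit Types (f g x : 'rV[R]_m) (T : seq {set {set 'I_m}}).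

Local Notation tmin_cone := (tmin_cone a h).
Local Notation mst_coneE := (mst_coneE a_span h_tri).
Local Notation tmin_cone_inter := (tmin_cone_inter a_span h_tri).
Local Notation tmin_cone_polyhedral := (tmin_cone_polyhedral a_span h_tri).

Lemma mst_fanP C : mst_fan a h C <->
  exists2 T, realizable a h T & cone_face (tmin_cone T) C.
Proof.
split=> [[T [rT]]|[T rT]]; first by rewrite mst_coneE // => TC; exists T.
by exists T; rewrite mst_coneE.
Qed.

Lemma mst_fan_tmin_cone T : realizable a h T -> mst_fan a h (tmin_cone T).
Proof. by move=> rT; apply/mst_fanP; exists T => //; apply: cone_face_refl. Qed.

Lemma finite_realizable : finite_set [set T | realizable a h T].
Proof.
have [[T0 [oT0 _]]|none] := pselect (exists T, realizable a h T); last first.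
  have -> : [set T | realizable a h T] = set0; last exact: finite_set0.
  by apply/seteqP; split=> // T rT; apply: none; exists T.
pose f (t : (size T0).-tuple {set {set 'I_m}}) := val t.
apply: (@sub_finite_set _ _ (f @` setT)); last exact: finite_image.
move=> T [oT _]; have /eqP sz := spanning_tree_size (@Gamma_graph R m n a h) oT oT0.
by exists (Tuple sz).
Qed.

Lemma finite_mst_fan : finite_set (mst_fan a h).
Proof.
apply: (@sub_finite_set _ _
  (\bigcup_(T in [set T | realizable a h T]) [set C | cone_face (tmin_cone T) C])).
  by move=> C /mst_fanP[T rT TC]; exists T.
apply: bigcup_finite; first exact: finite_realizable.
by move=> T [oT _]; apply/finite_faces/tmin_cone_polyhedral.
Qed.

Lemma mst_fan_is_fan : is_fan (mst_fan a h).
Proof.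
split; first exact: finite_mst_fan.
- move=> C /mst_fanP[T [oT _]]; exact/cone_face_polyhedral/tmin_cone_polyhedral.
- move=> C D /mst_fanP[T rT TC] CD; apply/mst_fanP; exists T => //.
  by apply: cone_face_trans TC CD; apply: tmin_cone_polyhedral; case: rT.
move=> C D /mst_fanP[T [oT _] TC] /mst_fanP[T' [oT' _] TD]; split.
  apply: (cone_face_inter (tmin_cone_polyhedral oT) _ TC TD).
  exact: tmin_cone_inter.
rewrite setIC; apply: (cone_face_inter (tmin_cone_polyhedral oT') _ TD TC).
exact: tmin_cone_inter.
Qed.

Lemma realizable_absorbing T : realizable a h T -> exists g, absorbing (tmin_cone T) g.
Proof. by move=> [oT [g gT]]; exists g; apply: tmin_cone_absorbing. Qed.

Lemma tmin_cone_maximal T D : realizable a h T -> mst_fan a h D ->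
  tmin_cone T `<=` D -> D = tmin_cone T.
Proof.
move=> rT /mst_fanP[T' rT' T'D] TD.
have TT' : tmin_cone T `<=` tmin_cone T'.
  by apply: subset_trans TD _; apply: cone_face_sub.
have face : cone_face (tmin_cone T') (tmin_cone T).
  rewrite -(setIidr TT'); apply: tmin_cone_inter; [by case: rT'|by case: rT].
have [g Tg] := realizable_absorbing rT.
have TE := absorbing_face face Tg.
by apply/seteqP; split=> //; rewrite TE; apply: cone_face_sub.
Qed.

Lemma maximal_conesE :
  maximal_cones (mst_fan a h) = mst_cone a h @` [set T | realizable a h T].
Proof.
apply/seteqP; split=> [C [/mst_fanP[T rT TC] Cmax]|_ [T rT <-]].
  exists T => //; rewrite mst_coneE //; apply: Cmax; last exact: cone_face_sub.
  exact: mst_fan_tmin_cone.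
rewrite mst_coneE //; split; first exact: mst_fan_tmin_cone.
by move=> D KD TD; apply: tmin_cone_maximal.
Qed.

Lemma mst_cone_eqP T T' : realizable a h T -> realizable a h T' ->
  mst_cone a h T = mst_cone a h T' <->
  exists g, mst_generic_cone a h T g /\ mst_generic_cone a h T' g.
Proof.
move=> rT rT'; have [[oT [g0 g0T]] [oT' _]] := (rT, rT').
rewrite !mst_coneE //; split=> [TT'|[g [gT gT']]].
  exists g0; split=> //; have [gg scg tg] := g0T; split=> //.
  by have : tmin_cone T g0 by []; rewrite TT' => -[].
have ab : absorbing (tmin_cone T `&` tmin_cone T') g.
  by move=> v; apply: filterI; apply: tmin_cone_absorbing.
rewrite -(absorbing_face (tmin_cone_inter oT oT') ab).
by rewrite setIC in ab *; apply: absorbing_face (tmin_cone_inter oT' oT) ab.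
Qed.

Lemma mst_cone_inj : {in Gamma a h &, injective (edge_length a h)} ->
  forall T T', realizable a h T -> realizable a h T' ->
  mst_cone a h T = mst_cone a h T' -> T = T'.
Proof.
move=> len_inj T T' rT rT' /(mst_cone_eqP rT rT')[g [[gg scg gT] [_ _ gT']]].
have [[oT _] [oT' _]] := (rT, rT').
have [_ sT _ _] := oT.
have /(Tmin_greedy a_span h_tri _ scg)[_ {}gT] := gT.
have /(Tmin_greedy a_span h_tri _ scg)[_ {}gT'] := gT'.
apply: (greedy_for_unique (@Gamma_graph R m n a h) oT oT' _ gT gT').
move=> r s /sT rG sG rs sr; apply: len_inj => //.
rewrite !(edge_length_coef a_span h_tri (@secondary_cone_h R m n a h)) //.
apply: (generic_edge_tie a_span h_tri gg rG sG).
by apply/eqP; rewrite eq_le; apply/andP; split.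
Qed.

Lemma tmin_cone_common f g T : secondary_cone a h f -> secondary_cone a h g ->
  ordered_spanning_tree a h T -> Tmin a h f T -> Tmin a h g T ->
  exists2 T', realizable a h T' & tmin_cone T' f /\ tmin_cone T' g.
Proof.
move=> scf scg oT fT gT.
have fg : tmin_cone T (f + 1 *: g) by apply: tmin_cone_ray.
have [T' [rT' fgT']] := exists_realizable a_span h_gen h_tri fg.1.
have [oT' _] := rT'; exists T' => //.
have Tf : tmin_cone T f by [].
have Tg : tmin_cone T g by [].
have T'fg : tmin_cone T' (f + 1 *: g) by split=> //; case: fg.
have lef := tmin_cone_flag_le a_span h_tri oT' Tf.
have leg := tmin_cone_flag_le a_span h_tri oT' Tg.
have lefg := tmin_cone_flag_le a_span h_tri oT T'fg.
rewrite !dotp_ray !mul1r in lefg.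
by split; [apply: (tmin_cone_flag_eq a_span h_tri oT' Tf)
          |apply: (tmin_cone_flag_eq a_span h_tri oT' Tg)]; lra.
Qed.

End MSTFan.

Theorem theorem4p3 (R : realType) (m n : nat) (a : 'I_m -> 'rV[R]_n)
    (h : 'rV[R]_m) (a_inj : injective a) (a_span : affinely_spanning a)
    (h_gen : generic a h) (h_tri : triangulation a h) :
  [/\ is_fan (mst_fan a h) /\ pure (mst_fan a h),
      \bigcup_(C in mst_fan a h) C = secondary_cone a h,
      (forall f g, secondary_cone a h f -> secondary_cone a h g ->
         ((exists C, [/\ mst_fan a h C, C f & C g]) <->
          (exists T, [/\ ordered_spanning_tree a h T,
                         Tmin a h f T & Tmin a h g T]))),
      (* The map sending T to its cone is onto the maximal cones and identifies
         only trees that are tied at some generic height function. *)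
      (mst_cone a h @` [set T | realizable a h T] = maximal_cones (mst_fan a h)
       /\ forall T T', realizable a h T -> realizable a h T' ->
            (mst_cone a h T = mst_cone a h T' <->
             exists g, mst_generic_cone a h T g /\ mst_generic_cone a h T' g))
    & (* Without coinciding edge lengths it is a bijection. *)
      ({in Gamma a h &, injective (edge_length a h)} ->
       set_bij [set T | realizable a h T] (maximal_cones (mst_fan a h))
               (mst_cone a h))].
Proof.
split.
- split; first exact: mst_fan_is_fan.
  exists m => C; rewrite maximal_conesE // => -[T rT <-]; rewrite mst_coneE //.
  have [g Tg] := realizable_absorbing a_span h_tri rT.
  exact: absorbing_cone_dim Tg.
- apply/seteqP; split=> [g [C /(mst_fanP a_span h_tri)[T _ TC] Cg]|g scg].
    by have [] := cone_face_sub TC Cg.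
  have [T [rT gT]] := exists_realizable a_span h_gen h_tri scg.
  by exists (tmin_cone a h T); first exact: mst_fan_tmin_cone.
- move=> f g scf scg; split.
    move=> [C [/(mst_fanP a_span h_tri)[T [oT _] TC] Cf Cg]]; exists T.
    by split=> //; [have [] := cone_face_sub TC Cf|have [] := cone_face_sub TC Cg].
  move=> [T [oT fT gT]].
  have [T' rT' [T'f T'g]] := tmin_cone_common a_span h_gen h_tri scf scg oT fT gT.
  by exists (tmin_cone a h T'); split=> //; apply: mst_fan_tmin_cone.
- by split=> [|T T' rT rT']; [rewrite maximal_conesE|apply: mst_cone_eqP].
move=> len_inj; split.
- by move=> T rT; rewrite maximal_conesE //; exists T.
- by move=> T T'; rewrite !inE => rT rT'; apply: mst_cone_inj.
by move=> C; rewrite maximal_conesE.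
Qed.
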